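(* Let $\kappa_0>0$ and let $\alpha\ge1$, $\beta\ge1$ be real numbers satisfying one of the following two conditions: (a) $\beta=1$, and $\alpha=1$ or $\alpha\ge2$; (b) $\beta=2$ or $\beta\ge3$, and $\alpha=1$. Let $(v_0,\omega_0)\in H^5(\mathbb T)\times H^5(\mathbb T)$ with $\omega_0\ge0$, such that: $v_0$ is odd and $\omega_0$ is even with respect to $x=0$; $\omega_0(0)=0$ and $\partial_x^2\omega_0(0)>0$; and, in case (b), additionally $\partial_x v_0(0)\ge\sqrt{2\,\partial_x^2\omega_0(0)}$. Then there exists a time $t_0>0$ with the following property: if $(v,\omega)$ is a classical solution of $$\partial_t v-\partial_x(\omega^\alpha\partial_x v)=0,\qquad \partial_t\omega-\kappa_0\partial_x(\omega^\beta\partial_x\omega)=\omega^\alpha|\partial_x v|^2,\qquad (v,\omega)_{|t=0}=(v_0,\omega_0),$$ on $[0,t_0)\times\mathbb T$ with $v,\omega\in C([0,t_0);H^5(\mathbb T))$ (i.e. the solution does not break down earlier at another time or place), then $$\lim_{t\to t_0^-}\partial_x^2\omega(t,0)=+\infty .$$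
   Context: $\mathbb T=[-\pi,\pi]/\sim$ is the one-dimensional torus; a function $f$ on $\mathbb T$ is odd (resp. even) with respect to $0$ if $f(-x)=-f(x)$ (resp. $f(-x)=f(x)$). $H^5(\mathbb T)$ is the Sobolev space of order 5 on $\mathbb T$. *)

(* Defs.v *)
From HB Require Import structures.
From mathcomp Require Import all_boot all_order all_algebra.
From mathcomp Require Import all_classical all_reals all_analysis.
Set Implicit Arguments. Unset Strict Implicit. Unset Printing Implicit Defensive.
Import Order.TTheory GRing.Theory Num.Theory.
Import numFieldNormedType.Exports.
Local Open Scope classical_set_scope.
Local Open Scope ring_scope.

Section Defs.
Variable R : realType.

(* A function on the torus T = [-pi,pi]/~ is a 2pi-periodic function R -> R. *)
Definition periodic (f : R -> R) : Prop := forall x, f (x + 2 * pi) = f x.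

Definition odd_fun (f : R -> R) : Prop := forall x, f (- x) = - f x.
Definition even_fun (f : R -> R) : Prop := forall x, f (- x) = f x.

Definition Tdom : set R := `[- pi, pi]%classic.

Definition L2T (f : R -> R) : Prop :=
  measurable_fun Tdom f /\
  (@lebesgue_measure R).-integrable Tdom (fun x => ((f x) ^+ 2)%:E).

Definition test_fun (phi : R -> R) : Prop :=
  periodic phi /\ forall (n : nat) (x : R), derivable (derive1n n phi) x 1.

Definition weak_deriv (j : nat) (f g : R -> R) : Prop :=
  forall phi, test_fun phi ->
    (\int[@lebesgue_measure R]_(x in Tdom) (f x * derive1n j phi x)%:E =
     ((-1) ^+ j)%:E * \int[@lebesgue_measure R]_(x in Tdom) (g x * phi x)%:E)%E.

Definition H5_derivs (f : R -> R) (D : nat -> R -> R) : Prop :=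
  D 0%N = f /\ forall j : nat, (j <= 5)%N -> L2T (D j) /\ weak_deriv j f (D j).

(* f belongs to H^5(T); f is taken to be the continuous representative. *)
Definition H5 (f : R -> R) : Prop :=
  periodic f /\ continuous f /\ exists D, H5_derivs f D.

(* u in C([0,t0); H^5(T)) : each u t is in H^5(T) (continuous representative),
   and t |-> u t is continuous in the H^5 norm, i.e. each weak derivative up to
   order 5 is continuous in L^2(T). *)
Definition C_H5 (t0 : R) (u : R -> R -> R) : Prop :=
  exists D : nat -> R -> R -> R,
    (forall t, 0 <= t < t0 ->
       periodic (u t) /\ continuous (u t) /\ H5_derivs (u t) (fun j => D j t)) /\
    (forall j : nat, (j <= 5)%N -> forall t, 0 <= t < t0 ->
       forall e : R, 0 < e -> exists2 d : R, 0 < d &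
         forall s, 0 <= s < t0 -> `|s - t| < d ->
           (\int[@lebesgue_measure R]_(x in Tdom) ((D j s x - D j t x) ^+ 2)%:E
              < e%:E)%E).

Definition dx (u : R -> R -> R) (t x : R) : R := derive1 (fun y => u t y) x.
Definition dt (u : R -> R -> R) (t x : R) : R := derive1 (fun s => u s x) t.

(* (v, w) is a classical solution on [0,t0) x T of
     d_t v - d_x (w^alpha d_x v) = 0,
     d_t w - kappa0 d_x (w^beta d_x w) = w^alpha |d_x v|^2,
     (v, w)(0) = (v0, w0),
   with v, w in C([0,t0); H^5(T)).  The degenerate equations with real
   exponents are posed for the nonnegative unknown w. *)
Definition classical_solution (kappa0 alpha beta : R) (v0 w0 : R -> R)
    (t0 : R) (v w : R -> R -> R) : Prop :=
  C_H5 t0 v /\ C_H5 t0 w /\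
  v 0 = v0 /\ w 0 = w0 /\
  (forall t x, 0 <= t < t0 -> 0 <= w t x) /\
  (forall t x, 0 < t < t0 ->
     derivable (fun s => v s x) t 1 /\ derivable (fun s => w s x) t 1 /\
     derivable (fun y => v t y) x 1 /\ derivable (fun y => w t y) x 1 /\
     derivable (fun y => powR (w t y) alpha * dx v t y) x 1 /\
     derivable (fun y => powR (w t y) beta * dx w t y) x 1 /\
     dt v t x - derive1 (fun y => powR (w t y) alpha * dx v t y) x = 0 /\
     dt w t x - kappa0 * derive1 (fun y => powR (w t y) beta * dx w t y) x
       = powR (w t x) alpha * (dx v t x) ^+ 2).

End Defs.

(* Main.v *)
Require Import Defs.
From HB Require Import structures.
From mathcomp Require Import all_boot all_order all_algebra.
From mathcomp Require Import all_classical all_reals all_analysis.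
From mathcomp Require Import measurable_realfun ring lra.
Import Order.TTheory GRing.Theory Num.Theory.
Import numFieldNormedType.Exports.
Local Open Scope classical_set_scope.
Local Open Scope ring_scope.

(** Put [a t] and [b t] for the second derivative of [w t] and the first
    derivative of [v t] at the origin.  A nonnegative [C^2] function satisfies
    [w_x^2 <= 4 M w], so the equation gives [|w_t| <= L w] at the origin and
    Gronwall propagates [w t 0 = 0].  Comparing the Taylor coefficients at the
    origin of both sides of the equations then yields the closed system
    [a' = 3 kappa0 a^2 [beta = 1] + a b^2 [alpha = 1]], and [b' = a b] if
    [alpha = 1].  If [beta = 1], [a' >= 3 kappa0 a^2]; in case (b),
    [b^2 - 2 a] is conserved and initially nonnegative, so [a' = a b^2 >= 2 a^2].
    Hence [a t >= a 0 / (1 - K a 0 t)] with [K = 3 kappa0] or [K = 2], and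
    [t0 = 1 / (K a 0)] works.

    The [C^2] regularity in space, uniform in time, comes from the third weak
    derivative only: its iterated zero-mean primitive differs from the function
    by a continuous function orthogonal to every nonconstant [cos (k x + theta)],
    and the kernels [(1 - cos d + cos (x - a))^n] show that such a function is
    constant. *)

(** The obstacle is regularity at the degenerate point. Differentiating the equations in [x] at the
    origin would call for mixed derivatives in time and space, which a classical solution does not
    provide. The coefficients are therefore differentiated in time as limits: at fixed [x] the mean
    value theorem in time turns the increment of [w / x ^ 2], or of [(v - v 0) / x], into a value of
    the right-hand side divided by the same power of [x], and this quotient has a joint limit as
    time tends to [t] and [x] to 0. The joint limit is what requires spatial regularity uniform in
    time; it is obtained from a bound linear in L^1 norms, which applies to the difference of two
    time slices.

    The exponents enter the system through the limits of [w ^ (alpha - 1)] and [w ^ (beta - 1)] as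
    [w] tends to 0: 1 if the exponent [alpha] or [beta] is 1, and 0 if it is at least 2. For
    [beta = 1] the diffusion contributes [w_x ^ 2 + w * w_xx], of order [(1 + 1/2) a ^ 2 x ^ 2];
    since [a] is twice the coefficient of [x ^ 2], this gives the 3 in [3 kappa0]. *)

Local Notation mu := (@lebesgue_measure _).

(** * Integrals over a segment *)

Lemma within_continuous_integrable (R : realType) (a b : R) (f : R -> R) :
  {within `[a, b], continuous f} -> mu.-integrable `[a, b] (EFin \o f).
Proof.
by apply: continuous_compact_integrable; exact: segment_compact.
Qed.

Lemma within_continuous_bounded (R : realType) (a b : R) (f : R -> R) :
  {within `[a, b], continuous f} ->
  exists2 M : R, 0 < M & forall x, x \in `[a, b] -> `|f x| <= M.
Proof.
move=> cf.
have : compact (f @` `[a, b]) by apply: continuous_compact => //; exact: segment_compact.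
move=> /compact_bounded[M [_ MB]].
exists (Num.max (M + 1) 1); first by rewrite lt_max ltr01 orbT.
move=> x xab; rewrite le_max (MB (M + 1)) ?ltrDl//.
Qed.

Lemma integrable_mulr_continuous (R : realType) (a b : R) (f g : R -> R) :
  mu.-integrable `[a, b] (EFin \o f) -> {within `[a, b], continuous g} ->
  mu.-integrable `[a, b] (EFin \o (fun x => f x * g x)).
Proof.
move=> fi cg.
have -> : EFin \o (fun x => f x * g x) = ((EFin \o f) \* (EFin \o g))%E.
  by apply/funext => x /=; rewrite EFinM.
apply: integrableMl => //.
- by apply: subspace_continuous_measurable_fun.
- have [M M0 MB] := @within_continuous_bounded R a b g cg.
  exists M; split; [exact: num_real|] => x Mx y yab /=.
  by rewrite (le_trans _ (ltW Mx))// MB//; exact/set_mem/mem_set.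
Qed.

Lemma integrable_EFinD (R : realType) (a b : R) (f g : R -> R) :
  mu.-integrable `[a, b] (EFin \o f) -> mu.-integrable `[a, b] (EFin \o g) ->
  mu.-integrable `[a, b] (EFin \o (fun x => f x + g x)).
Proof. by move=> fi gi; exact: (integrableD _ fi gi). Qed.

Lemma integrable_EFinB (R : realType) (a b : R) (f g : R -> R) :
  mu.-integrable `[a, b] (EFin \o f) -> mu.-integrable `[a, b] (EFin \o g) ->
  mu.-integrable `[a, b] (EFin \o (fun x => f x - g x)).
Proof. by move=> fi gi; exact: (integrableB _ fi gi). Qed.

Lemma integrable_EFinZ (R : realType) (a b k : R) (f : R -> R) :
  mu.-integrable `[a, b] (EFin \o f) ->
  mu.-integrable `[a, b] (EFin \o (fun x => k * f x)).
Proof. by move=> fi; exact: (integrableZl _ _ fi). Qed.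

Lemma integrable_cst (R : realType) (a b k : R) :
  mu.-integrable `[a, b] (EFin \o (fun=> k)).
Proof. by apply: within_continuous_integrable; exact/continuous_subspaceT/cst_continuous. Qed.

Lemma Rintegral_dist_le (R : realType) (a b M : R) (f g : R -> R) :
  a <= b ->
  mu.-integrable `[a, b] (EFin \o f) -> mu.-integrable `[a, b] (EFin \o g) ->
  (forall x, x \in `[a, b] -> `|f x - g x| <= M) ->
  `|\int[mu]_(x in `[a, b]) f x - \int[mu]_(x in `[a, b]) g x| <= M * (b - a).
Proof.
move=> ab fi gi fgM; rewrite -RintegralB//.
have fgi : mu.-integrable `[a, b] (EFin \o (fun x => f x - g x)).
  exact: integrable_EFinB.
apply: (le_trans (le_normr_Rintegral _ _)) => //.
apply: (@le_trans _ _ (\int[mu]_(x in `[a, b]) (cst M x))).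
  apply: le_Rintegral => //; first exact: integrable_norm.
  exact: integrable_cst.
rewrite Rintegral_cst//= lebesgue_measure_itv/= lte_fin.
by case: ltP => //= ba; rewrite mulr0 mulr_ge0// ?subr_ge0// (le_trans _ (fgM a _))// in_itv/= lexx.
Qed.

Lemma integrable_subitv (R : realType) (a b x : R) (f : R -> R) :
  x \in `[a, b] -> mu.-integrable `[a, b] (EFin \o f) ->
  mu.-integrable `[a, x] (EFin \o f).
Proof.
rewrite in_itv/= => /andP[ax xb]; apply: integrableS => //.
by apply: subset_itvl; rewrite bnd_simp.
Qed.

Lemma normr_Rintegral_subitv (R : realType) (a b x : R) (f : R -> R) :
  x \in `[a, b] -> mu.-integrable `[a, b] (EFin \o f) ->
  `|\int[mu]_(t in `[a, x]) f t| <= \int[mu]_(t in `[a, b]) `|f t|.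
Proof.
move=> xab fi.
have fxi := integrable_subitv _ _ _ _ _ xab fi.
apply: (le_trans (le_normr_Rintegral _ _)) => //.
have ni := integrable_norm fi.
apply: fine_le.
- exact/integrable_fin_num/integrable_norm.
- exact/integrable_fin_num.
- apply: ge0_subset_integral => //.
  + by case/integrableP : ni.
  + by move: xab; rewrite in_itv/= => /andP[? ?]; apply: subset_itvl; rewrite bnd_simp.
Qed.

Lemma integrable_primitive (R : realType) (a b : R) (f : R -> R) : a <= b ->
  mu.-integrable `[a, b] (EFin \o f) ->
  {within `[a, b], continuous (fun x => \int[mu]_(t in `[a, x]) f t)}.
Proof. exact: parameterized_integral_continuous. Qed.

Lemma continuous_integration_by_parts (R : realType) (a b : R) (g phi dphi : R -> R) :
  a < b -> continuous g ->
  (forall x : R, is_derive x 1 phi (dphi x)) -> continuous dphi ->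
  \int[mu]_(x in `[a, b]) ((\int[mu]_(t in `[a, x]) g t) * dphi x) =
  (\int[mu]_(x in `[a, b]) g x) * phi b - \int[mu]_(x in `[a, b]) (g x * phi x).
Proof.
move=> ab cg dphiP cdphi.
have wg c : {within `[a, c], continuous g} by exact: continuous_subspaceT.
have gi c := @within_continuous_integrable R a c g (wg c).
have cphi : continuous phi.
  by move=> x; apply/differentiable_continuous/derivable1_diffP; case: (dphiP x).
have cG := @integrable_primitive R a b g (ltW ab) (gi b).
have /(continuous_within_itvP _ ab)[_ cGa cGb] := cG.
rewrite (@Rintegration_by_parts R _ phi g dphi)//.
- by rewrite [X in _ - X * _]/= set_itv1 Rintegral_set1 mul0r subr0.
- split => // x; rewrite in_itv/= => /andP[ax xb].
  exact: (continuous_FTC1_closed xb (gi b) ax (cg x)).1.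
- move=> x; rewrite in_itv/= => /andP[ax xb].
  exact: (continuous_FTC1_closed xb (gi b) ax (cg x)).2.
- exact: continuous_subspaceT.
- split => [x _||]; first by case: (dphiP x).
  + exact/cvg_at_right_filter/cphi.
  + exact/cvg_at_left_filter/cphi.
- by move=> x _; rewrite derive1E; case: (dphiP x).
Qed.

(** Both sides are continuous in [f] for the L^1 distance and agree for continuous integrands, which
    are dense in L^1. *)
Lemma integrable_integration_by_parts (R : realType) (a b : R) (f phi dphi : R -> R) :
  a < b -> mu.-integrable `[a, b] (EFin \o f) ->
  (forall x : R, is_derive x 1 phi (dphi x)) -> continuous dphi ->
  \int[mu]_(x in `[a, b]) ((\int[mu]_(t in `[a, x]) f t) * dphi x) =
  (\int[mu]_(x in `[a, b]) f x) * phi b - \int[mu]_(x in `[a, b]) (f x * phi x).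
Proof.
move=> ab fi dphiP cdphi.
have cphi : continuous phi.
  by move=> x; apply/differentiable_continuous/derivable1_diffP; case: (dphiP x).
have [M M0 phiM] := @within_continuous_bounded R a b phi (continuous_subspaceT cphi).
have [N N0 dphiN] := @within_continuous_bounded R a b dphi (continuous_subspaceT cdphi).
have muab : (mu `[a, b] < +oo)%E.
  by rewrite lebesgue_measure_itv/=; case: ifP => //; rewrite -EFinB ltry.
have [g [cg gi gcvg]] := approximation_continuous_integrable (measurable_itv _) muab fi.
apply/eqP; rewrite -subr_eq0 -normr_le0; apply/ler_addgt0Pr => e e0; rewrite add0r.
(* [K] adds up the factors of the L^1 error in three places: the integrated primitive
   ([N * (b - a)]), the boundary term ([M]) and the last integral ([M]). *)
pose K := N * (b - a) + M + M.
have K0 : 0 < K by rewrite !addr_gt0// mulr_gt0// subr_gt0.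
have eK0 : 0 < e / K by rewrite divr_gt0.
pose Ef n := \int[mu]_(x in `[a, b]) `|f x - g n x|.
have Ef0 : Ef n @[n --> \oo] --> 0 by exact: (fine_cvg gcvg).
have /cvgrPdist_lt/(_ _ eK0)[n _ /(_ n (leqnn n))] := Ef0.
rewrite sub0r normrN => En.
have fgi : mu.-integrable `[a, b] (EFin \o (fun x => f x - g n x)).
  exact: integrable_EFinB.
pose E := \int[mu]_(x in `[a, b]) `|f x - g n x|.
have EeK : E <= e / K by apply: le_trans (ltW En); exact: ler_norm.
have E0 : 0 <= E by exact: Rintegral_ge0.
have IBP := @continuous_integration_by_parts R a b (g n) phi dphi ab (cg n) dphiP cdphi.
have wphi : {within `[a, b], continuous phi} := continuous_subspaceT cphi.
have wdphi : {within `[a, b], continuous dphi} := continuous_subspaceT cdphi.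
have prim (h : R -> R) : mu.-integrable `[a, b] (EFin \o h) -> mu.-integrable `[a, b]
    (EFin \o (fun x => (\int[mu]_(t in `[a, x]) h t) * dphi x)).
  move=> hi; apply: integrable_mulr_continuous => //.
  by apply: within_continuous_integrable; apply: integrable_primitive => //; exact: ltW.
have B1 : `|\int[mu]_(x in `[a, b]) ((\int[mu]_(t in `[a, x]) f t) * dphi x) -
    \int[mu]_(x in `[a, b]) ((\int[mu]_(t in `[a, x]) g n t) * dphi x)| <= (E * N) * (b - a).
  apply: Rintegral_dist_le; [exact: ltW|exact: prim|exact: prim|] => x xab.
  rewrite -mulrBl normrM ler_pM// ?dphiN//.
  have ifx := integrable_subitv _ _ _ _ _ xab fi.
  have igx := integrable_subitv _ _ _ _ _ xab (gi n).
  rewrite -RintegralB//; exact: normr_Rintegral_subitv.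
have B2 : `|\int[mu]_(x in `[a, b]) f x - \int[mu]_(x in `[a, b]) g n x| <= E.
  by rewrite -RintegralB//; exact: le_normr_Rintegral.
have B3 : `|\int[mu]_(x in `[a, b]) (f x * phi x) - \int[mu]_(x in `[a, b]) (g n x * phi x)| <= E * M.
  rewrite -RintegralB//; [|exact: integrable_mulr_continuous..].
  under eq_Rintegral do rewrite -mulrBl.
  have fgpi := @integrable_mulr_continuous _ _ _ _ _ fgi wphi.
  apply: (le_trans (le_normr_Rintegral _ _)) => //.
  rewrite -RintegralZr//; last exact: integrable_norm.
  apply: le_Rintegral => //; first exact: integrable_norm.
  - apply: (@integrable_mulr_continuous _ _ _ _ (cst M)); first exact: integrable_norm fgi.
    exact/continuous_subspaceT/cst_continuous.
  - by move=> x xab; rewrite normrM ler_wpM2l// phiM// -in_setE.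
have bab : `|phi b| <= M by apply: phiM; rewrite in_itv/= lexx ltW.
set X := (\int[mu]_(x in `[a, b]) ((\int[mu]_(t in `[a, x]) f t) * dphi x)) in B1 *.
set Y := \int[mu]_(x in `[a, b]) f x in B2 *.
set Z := \int[mu]_(x in `[a, b]) (f x * phi x) in B3 *.
move: IBP B1 B2 B3.
set X' := (\int[mu]_(x in `[a, b]) ((\int[mu]_(t in `[a, x]) g n t) * dphi x)).
set Y' := \int[mu]_(x in `[a, b]) g n x.
set Z' := \int[mu]_(x in `[a, b]) (g n x * phi x).
move=> IBP B1 B2 B3.
have -> : X - (Y * phi b - Z) = (X - X') - (Y - Y') * phi b + (Z - Z') by rewrite IBP; ring.
apply: (@le_trans _ _ (E * K)); last by rewrite -ler_pdivlMr.
apply: (le_trans (ler_normD _ _)); apply: (@le_trans _ _ (E * N * (b - a) + E * M + E * M)); last by rewrite /K; lra.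
rewrite lerD//; apply: (le_trans (ler_normB _ _)); rewrite lerD// normrM ler_pM//.
Qed.

(** * Continuous functions orthogonal to trigonometric polynomials *)

(** Bernoulli's inequality, then the archimedean property. *)
Lemma pow_unbounded (R : realType) (q X : R) : 1 < q -> exists n, X < q ^+ n.
Proof.
move=> q1; have Bern n : 1 + n%:R * (q - 1) <= q ^+ n.
  elim: n => [|n IH]; first by rewrite mul0r addr0 expr0.
  rewrite exprS; apply: (@le_trans _ _ (q * (1 + n%:R * (q - 1)))).
    rewrite -[n.+1%:R]natr1; have : 0 <= n%:R * ((q - 1) * (q - 1)) by rewrite mulr_ge0// -expr2 sqr_ge0.
    by move: (n%:R : R) => m; nra.
  by rewrite ler_pM2l// (lt_trans ltr01).
exists (Num.truncn (`|X| / (q - 1))).+1; apply: lt_le_trans (Bern _).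
have q10 : 0 < q - 1 by rewrite subr_gt0.
apply: (@le_lt_trans _ _ `|X|); first exact: ler_norm.
have := truncnS_gt (`|X| / (q - 1)); rewrite ltr_pdivrMr// => H.
by apply: (lt_trans H); rewrite ltrDr.
Qed.

Lemma within_continuousM (R : realType) (A : set R) (f g : R -> R) :
  {within A, continuous f} -> {within A, continuous g} ->
  {within A, continuous (fun x => f x * g x)}.
Proof. by move=> cf cg x; apply: cvgM; [exact: cf|exact: cg]. Qed.

Lemma within_continuousX (R : realType) (A : set R) (f : R -> R) n :
  {within A, continuous f} -> {within A, continuous (fun x => f x ^+ n)}.
Proof.
move=> cf; elim: n => [|n IH].
  under eq_fun do rewrite expr0.
  exact/continuous_subspaceT/cst_continuous.
by under eq_fun do rewrite exprS; exact: within_continuousM.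
Qed.

Lemma continuous_cos_affine (R : realType) (k theta : R) :
  continuous (fun x : R => cos (k * x + theta)).
Proof.
move=> x; apply: continuous_comp; last exact: continuous_cos.
by apply: cvgD; [apply: cvgM; [exact: cvg_cst|exact: cvg_id]|exact: cvg_cst].
Qed.

Lemma continuous_cos_translate (R : realType) (c : R) :
  continuous (fun x : R => cos (x + c)).
Proof.
rewrite (_ : (fun x => _) = (fun x : R => cos (1 * x + c))); first exact: continuous_cos_affine.
by apply/funext => x; rewrite mul1r.
Qed.

(** Powers of the kernel are trigonometric polynomials. Rather than expanding them, the induction
    peels off one factor at a time with [cos u * cos s = (cos (u + s) + cos (u - s)) / 2]. *)
Lemma orthogonal_cos_kernel (R : realType) (h : R -> R) (c d : R) :
  {within `[- pi, pi], continuous h} ->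
  (forall (k : int) theta,
    \int[mu]_(x in `[- pi, pi]) (h x * cos (k%:~R * x + theta)) = 0) ->
  forall n, \int[mu]_(x in `[- pi, pi]) (h x * (d + cos (x + c)) ^+ n) = 0.
Proof.
move=> ch h0 n.
(* The extra factor [cos (k x + theta)], for every frequency and phase, absorbs the shifts of the
   product-to-sum formula; [k = 0], [theta = 0] recovers the goal. *)
suff H (k : int) theta : \int[mu]_(x in `[- pi, pi])
    (h x * cos (k%:~R * x + theta) * (d + cos (x + c)) ^+ n) = 0.
  rewrite -[RHS](H 0 0); apply: eq_Rintegral => x _.
  by rewrite mul0r addr0 cos0 mulr1.
have cp m : {within `[- pi, pi], continuous (fun x => (d + cos (x + c)) ^+ m)}.
  apply: within_continuousX; apply: continuous_subspaceT => x.
  apply: cvgD; first exact: cvg_cst.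
  exact: continuous_cos_translate.
have chc (k' : int) theta' m : mu.-integrable `[- pi, pi]
   (EFin \o (fun x => h x * cos (k'%:~R * x + theta') * (d + cos (x + c)) ^+ m)).
  apply: within_continuous_integrable; apply: within_continuousM => //.
  apply: within_continuousM => //; exact/continuous_subspaceT/continuous_cos_affine.
elim: n k theta => [|n IH] k theta.
  by rewrite -[RHS](h0 k theta); apply: eq_Rintegral => x _; rewrite expr0 mulr1.
transitivity (\int[mu]_(x in `[- pi, pi])
  (d * (h x * cos (k%:~R * x + theta) * (d + cos (x + c)) ^+ n) +
   2^-1 * (h x * cos ((k + 1)%:~R * x + (theta + c)) * (d + cos (x + c)) ^+ n +
   h x * cos ((k - 1)%:~R * x + (theta - c)) * (d + cos (x + c)) ^+ n))).
  apply: eq_Rintegral => x _.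
  have -> : (k + 1)%:~R * x + (theta + c) = (k%:~R * x + theta) + (x + c) by rewrite intrD; ring.
  have -> : (k - 1)%:~R * x + (theta - c) = (k%:~R * x + theta) - (x + c) by rewrite intrB; ring.
  move: (k%:~R * x + theta) (x + c) => u s.
  by rewrite cosD cosB exprS; field.
have sumi k1 t1 k2 t2 := @integrable_EFinD R _ _ _ _ (chc k1 t1 n) (chc k2 t2 n).
rewrite RintegralD//; [|exact: integrable_EFinZ|exact/integrable_EFinZ/sumi].
rewrite RintegralZl// RintegralZl// RintegralD//.
by rewrite !IH !addr0 !mulr0 addr0.
Qed.

Lemma ler_cos (R : realType) : {in `[0, pi] &, {mono @cos R : x y /~ y <= x}}.
Proof. by move=> x y xI yI; rewrite !leNgt ltr_cos. Qed.

Lemma Rintegral_indic_itv (R : realType) (a b c d : R) : a <= c -> c < d -> d <= b ->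
  \int[mu]_(x in `[a, b]) \1_(`[c, d]%classic : set R) x = d - c.
Proof.
move=> ac cd db; rewrite /Rintegral integral_indic//=.
rewrite setIidl; last first.
  by move=> x /=; rewrite !in_itv/= => /andP[? ?]; apply/andP; split; lra.
by rewrite lebesgue_measure_itv/= lte_fin cd -EFinB.
Qed.

Lemma ler_cos_near (R : realType) (d y : R) : d <= pi -> `|y| <= d -> cos d <= cos y.
Proof.
move=> dpi yd; have d0 := le_trans (normr_ge0 y) yd.
by rewrite -(cos_norm y) ler_cos// in_itv/= ?d0// normr_ge0 (le_trans yd).
Qed.

(** The difference of two points of the period may exceed [pi] in absolute value; reflecting it to
    [2 pi - |y|] brings it back to the interval where cosine decreases. *)
Lemma ler_cos_far (R : realType) (d y : R) :
  0 <= d <= pi -> d <= `|y| -> `|y| <= 2 * pi - d -> cos y <= cos d.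
Proof.
move=> /andP[d0 dpi] dy yd; rewrite -(cos_norm y).
have [ypi|ypi] := leP `|y| pi.
  by rewrite ler_cos// in_itv/= ?d0// normr_ge0.
have -> : cos `|y| = cos (2 * pi - `|y|).
  by rewrite cosB mulr_natl cos2pi sin2pi mul1r mul0r addr0.
by rewrite ler_cos ?in_itv/= ?d0//; lra.
Qed.

(** If [h a > 0], the integral of [h * p ^ n], which is 0, would be arbitrarily large: [p] exceeds
    some [q > 1] close to [a], and [|p| <= 1] wherever [h] is not known to be positive. *)
Lemma orthogonal_cos_le0 (R : realType) (h : R -> R) :
  {within `[- pi, pi], continuous h} ->
  (forall (k : int) theta,
    \int[mu]_(x in `[- pi, pi]) (h x * cos (k%:~R * x + theta)) = 0) ->
  forall a, a \in `]- pi, pi[ -> h a <= 0.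
Proof.
move=> ch h0 a aI; rewrite leNgt; apply/negP => ha.
have [M M0 hM] := @within_continuous_bounded R _ _ h ch.
move: (aI); rewrite in_itv/= => /andP[a1 a2].
have chA : {for a, continuous h}.
  have : {in `]- pi, pi[, continuous h}.
    by have /(continuous_within_itvP _ (lt_trans a1 a2))[] := ch.
  by apply.
have ha2 : 0 < h a / 2 by rewrite divr_gt0.
have /cvgrPdist_lt/(_ _ ha2)/nbhs_ballP[r /= r0 hr] := chA.
(* [2 e < r] gives the lower bound on [h] near [a]. [2 e] at most the distance from [a] to both end
   points gives [|x - a| <= 2 pi - 2 e] on the whole segment, so [cos (x - a)] does not climb above
   [cos (2 e)] again at the far end. *)
pose e := Num.min (r / 2) (Num.min (pi - a) (a + pi)) / 2.
have mr : Num.min (r / 2) (Num.min (pi - a) (a + pi)) <= r / 2 by rewrite ge_min lexx.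
have mp : Num.min (r / 2) (Num.min (pi - a) (a + pi)) <= pi - a by rewrite !ge_min lexx orbT.
have mm : Num.min (r / 2) (Num.min (pi - a) (a + pi)) <= a + pi by rewrite !ge_min lexx !orbT.
have e0 : 0 < e by rewrite divr_gt0// !lt_min divr_gt0//=; apply/andP; split; lra.
have er : e + e < r by rewrite /e; lra.
have ep : e + e <= pi - a by rewrite /e; lra.
have em : e + e <= a + pi by rewrite /e; lra.
move: e0 er ep em; move: e => {mr mp mm} e e0 er ep em.
(* [p >= 1] exactly where [|x - a| <= 2 e], and there [h >= h a / 2] *)
pose p x := (1 - cos (e + e)) + cos (x - a).
pose q := 1 - cos (e + e) + cos e.
have q1 : 1 < q.
  have : cos (e + e) < cos e by rewrite ltr_cos ?in_itv/= ?ltrDl//; apply/andP; split; lra.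
  by rewrite /q; lra.
(* With this [n] the gain [h a / 2 * q ^ n * e] over an interval of length [e] beats the possible
   loss [M * 2 pi] over the period. *)
have [n nq] := @pow_unbounded R q (M * (2 * pi) / (h a / 2 * e)) q1.
have Ip := @orthogonal_cos_kernel R h (- a) (1 - cos (e + e)) ch h0 n.
pose A : set R := `[a - e, a]%classic.
(* [g] is a minorant of [h * p ^ n] whose integral is explicit; [A] is one-sided because any
   interval of length [e] within [e] of [a] will do. *)
pose g x := h a / 2 * q ^+ n * \1_A x - M.
have pcont : {within `[- pi, pi], continuous (fun x => h x * p x ^+ n)}.
  apply: within_continuousM => //; apply: within_continuousX.
  apply: continuous_subspaceT => x; apply: cvgD; first exact: cvg_cst.
  exact: continuous_cos_translate.
have iA : mu.-integrable `[- pi, pi] (EFin \o (fun x => h a / 2 * q ^+ n * \1_A x)).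
  have iA1 : mu.-integrable `[- pi, pi] (EFin \o \1_A).
    by apply: (integrableS _ _ _ (integrable_indic_itv (a - e) a true false)).
  exact: integrable_EFinZ.
have iM := @integrable_cst R (- pi) pi M.
have : \int[mu]_(x in `[- pi, pi]) g x <= \int[mu]_(x in `[- pi, pi]) (h x * p x ^+ n).
  apply: le_Rintegral => //.
  - exact: integrable_EFinB.
  - exact: within_continuous_integrable.
  - move=> x xI.
    have hxM : `|h x| <= M by exact: hM.
    have {hxM} hxM : - M <= h x <= M by rewrite -ler_norml.
    have q0 : 0 <= q ^+ n by rewrite exprn_ge0// (le_trans ler01 (ltW q1)).
    have [xe|xe] := leP `|x - a| (e + e).
      have hx : h a / 2 <= h x.
        have : ball a r x by rewrite /ball/= distrC (le_lt_trans xe).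
        by move/hr => /=; rewrite ltr_distl; lra.
      have p1 : 1 <= p x.
        suff : cos (e + e) <= cos (x - a) by rewrite /p; clear; lra.
        by apply: ler_cos_near => //; clear -ep em; lra.
      have hp0 : 0 <= h x * p x ^+ n.
        by apply: mulr_ge0; [lra|apply: exprn_ge0; lra].
      rewrite /g indicE; have [/set_mem|xA] := boolP (x \in A); last by rewrite mulr0; lra.
      rewrite /A/= in_itv/= mulr1 => /andP[xa1 xa2].
      have qp : q <= p x.
        suff : cos e <= cos (x - a) by rewrite /p /q; clear; lra.
        by apply: ler_cos_near; [clear -ep em e0; lra|rewrite ler_norml; apply/andP; split; clear -xa1 xa2; lra].
      have : h a / 2 * q ^+ n <= h x * p x ^+ n.
        by apply: ler_pM => //; [lra|apply: lerXn2r => //; rewrite nnegrE; lra].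
      lra.
    rewrite /g indicE; have [/set_mem|xA] := boolP (x \in A).
      rewrite /A/= in_itv/= => /andP[xa1 xa2].
      by exfalso; move: xe; rewrite ltNge ler_norml => /negP; apply; apply/andP; split; lra.
    rewrite mulr0 sub0r.
    have p1 : `|p x| <= 1.
      have : cos (x - a) <= cos (e + e).
        have xI' : - pi <= x <= pi by move: xI => /=; rewrite in_itv.
        apply: ler_cos_far; [by apply/andP; split; clear -e0 ep em; lra|exact: ltW|].
        by rewrite ler_norml; apply/andP; split; clear -ep em xI'; lra.
      have := cos_geN1 (x - a); have := cos_le1 (e + e).
      by rewrite /p ler_norml; lra.
    have pn1 : `|p x ^+ n| <= 1 by rewrite normrX exprn_ile1.
    have : `|h x * p x ^+ n| <= M * 1 by rewrite normrM ler_pM// ler_norml.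
    by rewrite mulr1 ler_norml => /andP[].
rewrite Ip RintegralB// RintegralZl//; last first.
  by apply: (integrableS _ _ _ (integrable_indic_itv (a - e) a true false)).
rewrite Rintegral_cst//= lebesgue_measure_itv/= lte_fin.
have -> : - pi < pi :> R by rewrite gt0_cp ?pi_gt0.
rewrite Rintegral_indic_itv; [|clear -em e0 ep; lra..].
move: nq; rewrite ltr_pdivrMr ?mulr_gt0// opprK -EFinD/=; clear; lra.
Qed.

Lemma orthogonal_cos_eq0 (R : realType) (h : R -> R) :
  {within `[- pi, pi], continuous h} ->
  (forall (k : int) theta,
    \int[mu]_(x in `[- pi, pi]) (h x * cos (k%:~R * x + theta)) = 0) ->
  forall a, a \in `]- pi, pi[ -> h a = 0.
Proof.
move=> ch h0 a aI; apply/eqP; rewrite eq_le orthogonal_cos_le0//=.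
rewrite -oppr_le0; apply: (@orthogonal_cos_le0 R (fun x => - h x)) => //.
  by move=> x; apply: cvgN; exact: ch.
move=> k theta.
transitivity (\int[mu]_(x in `[- pi, pi]) (-1 * (h x * cos (k%:~R * x + theta)))).
  by apply: eq_Rintegral => x _; rewrite mulN1r mulNr.
rewrite RintegralZl// ?h0 ?mulr0//; apply: within_continuous_integrable.
apply: within_continuousM => //; exact/continuous_subspaceT/continuous_cos_affine.
Qed.

(** * Zero-mean primitives *)

(** Subtracting the mean fixes the constant of integration so that the result again has mean zero.
    Hence its own primitive takes equal values at both ends of the period, and the construction can
    be iterated on the torus. *)
Definition zero_mean_primitive (R : realType) (h : R -> R) (x : R) : R :=
  \int[mu]_(t in `[- pi, x]) h t -
  (2 * pi)^-1 * \int[mu]_(y in `[- pi, pi]) \int[mu]_(t in `[- pi, y]) h t.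

Lemma pi_itv_lt (R : realType) : - pi < pi :> R.
Proof. by rewrite gt0_cp ?pi_gt0. Qed.

Lemma within_continuousD_cst (R : realType) (A : set R) (f : R -> R) (c : R) :
  {within A, continuous f} -> {within A, continuous (fun x => f x + c)}.
Proof. by move=> cf x; apply: cvgD; [exact: cf|exact: cvg_cst]. Qed.

Lemma zero_mean_primitive_continuous (R : realType) (h : R -> R) :
  mu.-integrable `[- pi, pi] (EFin \o h) ->
  {within `[- pi, pi], continuous (zero_mean_primitive R h)}.
Proof.
move=> hi; apply: within_continuousD_cst.
by apply: integrable_primitive => //; exact/ltW/pi_itv_lt.
Qed.

Lemma integrable_zero_mean_primitive (R : realType) (h : R -> R) :
  mu.-integrable `[- pi, pi] (EFin \o h) ->
  mu.-integrable `[- pi, pi] (EFin \o zero_mean_primitive R h).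
Proof.
by move=> hi; exact/within_continuous_integrable/zero_mean_primitive_continuous.
Qed.

Lemma Rintegral_cst_pi (R : realType) (c : R) :
  \int[mu]_(x in `[- pi, pi]) c = c * (2 * pi).
Proof.
rewrite Rintegral_cst//= lebesgue_measure_itv/= lte_fin pi_itv_lt -EFinB/=; ring.
Qed.

Lemma integrable_raw_primitive (R : realType) (h : R -> R) :
  mu.-integrable `[- pi, pi] (EFin \o h) ->
  mu.-integrable `[- pi, pi] (EFin \o (fun x => \int[mu]_(t in `[- pi, x]) h t)).
Proof.
move=> hi; apply: within_continuous_integrable.
by apply: integrable_primitive => //; exact/ltW/pi_itv_lt.
Qed.

Lemma Rintegral_zero_mean_primitive (R : realType) (h : R -> R) :
  mu.-integrable `[- pi, pi] (EFin \o h) ->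
  \int[mu]_(x in `[- pi, pi]) zero_mean_primitive R h x = 0.
Proof.
move=> hi; rewrite RintegralB//; [|exact: integrable_raw_primitive|exact: integrable_cst].
rewrite Rintegral_cst_pi mulrAC mulVf ?mul1r ?subrr//.
by rewrite mulf_neq0// gt_eqF// pi_gt0.
Qed.

(** The factor 2 counts the raw primitive and its mean, each bounded by the L^1 norm of [h]. *)
Lemma zero_mean_primitive_le (R : realType) (h : R -> R) x : x \in `[- pi, pi] ->
  mu.-integrable `[- pi, pi] (EFin \o h) ->
  `|zero_mean_primitive R h x| <= 2 * \int[mu]_(t in `[- pi, pi]) `|h t|.
Proof.
move=> xI hi; rewrite mulr_natl mulr2n.
apply: (le_trans (ler_normB _ _)); rewrite lerD ?normr_Rintegral_subitv//.
have pi20 : 0 < 2 * pi :> R by rewrite mulr_gt0// pi_gt0.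
rewrite normrM gtr0_norm ?invr_gt0// mulrC ler_pdivrMr//.
have -> : 2 * pi = pi - (- pi) :> R by ring.
have := @Rintegral_dist_le R (- pi) pi (\int[mu]_(t in `[- pi, pi]) `|h t|) _ (fun=> 0)
  (ltW (pi_itv_lt R)) (integrable_raw_primitive R h hi) (integrable_cst R _ _ _).
rewrite Rintegral_cst_pi mul0r subr0; apply => y yI.
by rewrite subr0; exact: normr_Rintegral_subitv.
Qed.

Lemma Rintegral_derivative_eq0 (R : realType) (phi dphi : R -> R) :
  (forall x : R, is_derive x 1 phi (dphi x)) -> continuous dphi ->
  phi pi = phi (- pi) -> \int[mu]_(x in `[- pi, pi]) dphi x = 0.
Proof.
move=> dphiP cdphi phipi; have cphi : continuous phi.
  by move=> x; apply/differentiable_continuous/derivable1_diffP; case: (dphiP x).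
rewrite /Rintegral (@continuous_FTC2 R dphi phi)//.
- by rewrite phipi -EFinB subrr.
- exact: pi_itv_lt.
- exact: continuous_subspaceT.
- split => [x _||]; first by case: (dphiP x).
  + exact/cvg_at_right_filter/cphi.
  + exact/cvg_at_left_filter/cphi.
- by move=> x _; rewrite derive1E; case: (dphiP x).
Qed.

(** The mean of [h] being zero removes the boundary term; the equal end values of [phi] remove the
    contribution of the subtracted mean. *)
Lemma zero_mean_primitive_ibp (R : realType) (h phi dphi : R -> R) :
  mu.-integrable `[- pi, pi] (EFin \o h) -> \int[mu]_(x in `[- pi, pi]) h x = 0 ->
  (forall x : R, is_derive x 1 phi (dphi x)) -> continuous dphi ->
  phi pi = phi (- pi) ->
  \int[mu]_(x in `[- pi, pi]) (zero_mean_primitive R h x * dphi x) =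
  - \int[mu]_(x in `[- pi, pi]) (h x * phi x).
Proof.
move=> hi h0 dphiP cdphi phipi.
have wdphi : {within `[- pi, pi], continuous dphi} := continuous_subspaceT cdphi.
have dphii := @within_continuous_integrable R _ _ dphi wdphi.
transitivity (\int[mu]_(x in `[- pi, pi]) ((\int[mu]_(t in `[- pi, x]) h t) * dphi x -
    (2 * pi)^-1 * (\int[mu]_(y in `[- pi, pi]) \int[mu]_(t in `[- pi, y]) h t) * dphi x)).
  by apply: eq_Rintegral => x _; rewrite -mulrBl.
have rawi := integrable_raw_primitive R h hi.
rewrite RintegralB//; [|exact: integrable_mulr_continuous|exact: integrable_EFinZ].
rewrite RintegralZl//.
rewrite (@Rintegral_derivative_eq0 R phi dphi)//.
rewrite mulr0 subr0 (@integrable_integration_by_parts R _ _ h phi)//; last exact: pi_itv_lt.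
by rewrite h0 mul0r sub0r.
Qed.

Lemma within_continuous_in (R : realType) (a b : R) (f : R -> R) x :
  {within `[a, b], continuous f} -> x \in `]a, b[ -> {for x, continuous f}.
Proof.
move=> cf xI; have ab : a < b by move: xI; rewrite in_itv/= => /andP[]; exact: lt_trans.
by have /(continuous_within_itvP _ ab)[/(_ x xI)] := cf.
Qed.

Lemma is_derive_zero_mean_primitive (R : realType) (h : R -> R) x :
  {within `[- pi, pi], continuous h} -> x \in `]- pi, pi[ ->
  is_derive x 1 (zero_mean_primitive R h) (h x).
Proof.
move=> ch xI; have hx := @within_continuous_in R _ _ h x ch xI.
move: xI; rewrite in_itv/= => /andP[x1 x2].
have [D1 D2] := continuous_FTC1_closed x2 (@within_continuous_integrable R _ _ h ch) x1 hx.
have H : is_derive x 1 (fun y => \int[mu]_(t in `[- pi, y]) h t) (h x).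
  by split; [exact: D1|rewrite -derive1E; exact: D2].
by rewrite -[h x]subr0; exact: (is_deriveB H (is_derive_cst _ _ _)).
Qed.

Lemma cosD2kpi (R : realType) (x : R) (k : int) : cos (x + k%:~R * (2 * pi)) = cos x.
Proof.
have P n : forall y : R, cos (y + n%:R * (2 * pi)) = cos y.
  elim: n => [|n IH] y; first by rewrite mul0r addr0.
  by rewrite -natr1 mulrDl mul1r addrA cosD (mulr_natl pi 2) cos2pi sin2pi mulr1 mulr0 subr0 -(mulr_natl pi 2).
case: k => n; first exact: P.
by rewrite NegzE mulrNz mulNr -[LHS](P n.+1) subrK.
Qed.

(** Writing the derivative as a quarter-turn phase shift, and not with a sine, keeps the family
    [cos (k x + theta)] stable under differentiation. *)
Lemma is_derive_cos_affine (R : realType) (k theta x : R) :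
  is_derive x 1 (fun x => cos (k * x + theta)) (k * cos (k * x + (theta + pi / 2))).
Proof.
rewrite addrA cosDpihalf.
have H : is_derive x 1 (fun y : R => k * y + theta) k.
  by apply: is_derive_eq; rewrite addr0; exact: mulr1.
have := @is_derive1_comp R cos (fun y => k * y + theta) x _ _ (is_derive_cos _) H.
by rewrite mulrC.
Qed.

Lemma derive1n_cos_affine (R : realType) (k theta : R) n :
  derive1n n (fun x => cos (k * x + theta)) =
  (fun x => k ^+ n * cos (k * x + (theta + n%:R * (pi / 2)))).
Proof.
elim: n => [|n IH]; first by apply/funext => x; rewrite derive1n0 mul0r addr0 expr0 mul1r.
rewrite derive1nS IH; apply/funext => x; rewrite derive1E.
have D := @is_derive_cos_affine R k (theta + n%:R * (pi / 2)) x.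
rewrite (_ : (fun x => _) = (k ^+ n) \*: (fun x : R => cos (k * x + (theta + n%:R * (pi / 2)))))//.
rewrite deriveZ/=; last by case: D.
transitivity (k ^+ n * (k * cos (k * x + (theta + n%:R * (pi / 2) + pi / 2)))).
  by congr (_ * _); exact: derive_val.
have -> : n.+1%:R * (pi / 2) = n%:R * (pi / 2) + pi / 2 :> R by rewrite -(natr1 n); ring.
by rewrite mulrA -exprSr -[theta + _ + _]addrA.
Qed.

Lemma test_fun_cos (R : realType) (k : int) (theta : R) :
  test_fun (fun x => cos (k%:~R * x + theta)).
Proof.
split; first by move=> x; rewrite mulrDr addrAC cosD2kpi.
move=> n x; rewrite derive1n_cos_affine.
rewrite (_ : (fun x => _) =
  (k%:~R ^+ n) \*: (fun x : R => cos (k%:~R * x + (theta + n%:R * (pi / 2)))))//.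
Qed.

(** At a nonzero frequency [k], [k ^ 3] times the Fourier coefficient of [f], and of the triple
    primitive, is minus that of [D] with the phase moved by three quarter turns. The added mean
    settles frequency 0. *)
Lemma weak_deriv3_regular (R : realType) (f D : R -> R) (x : R) :
  continuous f -> mu.-integrable `[- pi, pi] (EFin \o D) ->
  (forall phi, test_fun phi ->
    \int[mu]_(x in `[- pi, pi]) (f x * derive1n 3 phi x) =
    - \int[mu]_(x in `[- pi, pi]) (D x * phi x)) ->
  x \in `]- pi, pi[ ->
  f x = zero_mean_primitive R (zero_mean_primitive R (zero_mean_primitive R D)) x +
    (2 * pi)^-1 * \int[mu]_(x in `[- pi, pi]) f x.
Proof.
move=> cf Di fD xI.
set g2 := zero_mean_primitive R D; set g1 := zero_mean_primitive R g2.
set g0 := zero_mean_primitive R g1; set m := _ * _.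
have pi20 : 2 * pi != 0 :> R by rewrite gt_eqF// mulr_gt0// pi_gt0.
(* Test against the constant 1, written [cos (0 * x + 0)], whose third derivative is 0. *)
have D0 : \int[mu]_(x in `[- pi, pi]) D x = 0.
  have := fD _ (test_fun_cos R 0 0).
  rewrite derive1n_cos_affine => /esym.
  under eq_Rintegral do rewrite mul0r addr0 cos0 mulr1.
  under [RHS]eq_Rintegral do rewrite expr0n/= mul0r mulr0.
  rewrite [RHS](_ : _ = 0); last by rewrite Rintegral_cst_pi mul0r.
  by move=> /eqP; rewrite oppr_eq0 => /eqP.
have g2i : mu.-integrable `[- pi, pi] (EFin \o g2) := integrable_zero_mean_primitive R _ Di.
have g1i : mu.-integrable `[- pi, pi] (EFin \o g1) := integrable_zero_mean_primitive R _ g2i.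
have g0i : mu.-integrable `[- pi, pi] (EFin \o g0) := integrable_zero_mean_primitive R _ g1i.
have g2m : \int[mu]_(x in `[- pi, pi]) g2 x = 0 := Rintegral_zero_mean_primitive R _ Di.
have g1m : \int[mu]_(x in `[- pi, pi]) g1 x = 0 := Rintegral_zero_mean_primitive R _ g2i.
have g0m : \int[mu]_(x in `[- pi, pi]) g0 x = 0 := Rintegral_zero_mean_primitive R _ g1i.
have wf : {within `[- pi, pi], continuous f} := continuous_subspaceT cf.
have fi := @within_continuous_integrable R _ _ f wf.
have dC (k : int) theta : continuous (fun x : R => k%:~R * cos (k%:~R * x + (theta + pi / 2))).
  by move=> y; apply: cvgM; [exact: cvg_cst|exact: continuous_cos_affine].
have pC (k : int) theta : cos (k%:~R * pi + theta) = cos (k%:~R * - pi + theta) :> R.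
  by rewrite -[RHS](cosD2kpi R _ k); congr cos; ring.
(* Taking a primitive divides a Fourier coefficient by [k], up to sign and a quarter turn of the
   phase. *)
have step (h : R -> R) (k : int) theta : mu.-integrable `[- pi, pi] (EFin \o h) ->
    \int[mu]_(x in `[- pi, pi]) h x = 0 ->
    k%:~R * \int[mu]_(x in `[- pi, pi]) (zero_mean_primitive R h x * cos (k%:~R * x + (theta + pi / 2))) =
    - \int[mu]_(x in `[- pi, pi]) (h x * cos (k%:~R * x + theta)).
  move=> hi h0.
  have <- := @zero_mean_primitive_ibp R h (fun x => cos (k%:~R * x + theta)) _ hi h0
    (is_derive_cos_affine R k%:~R theta) (dC k theta) (pC k theta).
  rewrite -RintegralZl//; first by apply: eq_Rintegral => y _; rewrite mulrCA.
  apply: integrable_mulr_continuous; first exact: integrable_zero_mean_primitive.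
  exact/continuous_subspaceT/continuous_cos_affine.
pose h x := f x - g0 x - m.
suff : h x = 0 by rewrite /h => /eqP; rewrite subr_eq0 subr_eq => /eqP ->; rewrite addrC.
have wg0 : {within `[- pi, pi], continuous g0}.
  exact: zero_mean_primitive_continuous.
have ch : {within `[- pi, pi], continuous h}.
  apply: within_continuousD_cst => y.
  by apply: cvgB; [exact: wf|exact: wg0].
apply: (@orthogonal_cos_eq0 R h ch) => // k theta.
have fg0i := @integrable_EFinB R _ _ _ _ fi g0i.
have [->|k0] := eqVneq k 0.
  under eq_Rintegral do rewrite mul0r add0r.
  rewrite RintegralZr//; last by apply: integrable_EFinB => //; exact: integrable_cst.
  rewrite RintegralB//; last exact: integrable_cst.
  by rewrite RintegralB// g0m subr0 Rintegral_cst_pi /m mulrAC mulVf// mul1r subrr mul0r.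
have kR : k%:~R != 0 :> R by rewrite intr_eq0.
(* Starting three quarter turns behind, the three integrations by parts end exactly at [theta]. *)
pose th := theta - 3%:R * (pi / 2).
pose C (u : R -> R) (t : R) := \int[mu]_(x in `[- pi, pi]) (u x * cos (k%:~R * x + t)).
have cC t : {within `[- pi, pi], continuous (fun x : R => cos (k%:~R * x + t))}.
  exact/continuous_subspaceT/continuous_cos_affine.
have s1 : k%:~R * C g2 (th + pi / 2) = - C D th := step D k th Di D0.
have s2 : k%:~R * C g1 (th + pi / 2 + pi / 2) = - C g2 (th + pi / 2) := step g2 k _ g2i g2m.
have s3 : k%:~R * C g0 (th + pi / 2 + pi / 2 + pi / 2) = - C g1 (th + pi / 2 + pi / 2) := step g1 k _ g1i g1m.
have s0 : k%:~R ^+ 3 * C f (th + 3%:R * (pi / 2)) = - C D th.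
  rewrite -(fD _ (test_fun_cos R k th)) derive1n_cos_affine -RintegralZl//.
    by apply: eq_Rintegral => y _; rewrite mulrCA.
  exact: integrable_mulr_continuous.
have E : th + pi / 2 + pi / 2 + pi / 2 = theta by rewrite /th; ring.
have E' : th + 3%:R * (pi / 2) = theta by rewrite /th; ring.
rewrite E in s3; rewrite E' in s0.
have C1 : C (fun=> m) theta = 0.
  have ci := @within_continuous_integrable R _ _ _ (cC theta).
  rewrite /C RintegralZl//.
  suff : k%:~R * \int[mu]_(x in `[- pi, pi]) cos (k%:~R * x + theta) = 0 :> R.
    by move=> /eqP; rewrite mulf_eq0 (negPf kR)/= => /eqP ->; rewrite mulr0.
  have Et : theta = theta - pi / 2 + pi / 2 by rewrite subrK.
  rewrite -RintegralZl// {1}Et.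
  exact: (@Rintegral_derivative_eq0 R _ _ (is_derive_cos_affine R k%:~R (theta - pi / 2))
    (dC k _) (pC k _)).
transitivity (C f theta - C g0 theta - C (fun=> m) theta).
  rewrite /C -RintegralB//; [|exact: integrable_mulr_continuous..].
  rewrite -RintegralB//; first by apply: eq_Rintegral => y _; rewrite /h; ring.
  - apply: integrable_EFinB; exact: integrable_mulr_continuous.
  - by apply: integrable_mulr_continuous => //; exact: integrable_cst.
rewrite C1 subr0.
suff : k%:~R ^+ 3 * (C f theta - C g0 theta) = 0.
  by move=> /eqP; rewrite mulf_eq0 expf_eq0/= (negPf kR)/= => /eqP.
have -> : k%:~R ^+ 3 * (C f theta - C g0 theta) =
  k%:~R ^+ 3 * C f theta - k%:~R ^+ 2 * (k%:~R * C g0 theta) by ring.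
rewrite s0 s3.
have -> : k%:~R ^+ 2 * - C g1 (th + pi / 2 + pi / 2) = - (k%:~R * (k%:~R * C g1 (th + pi / 2 + pi / 2))) by ring.
by rewrite s2 mulrN s1; ring.
Qed.

(** * From weak to classical derivatives *)

Lemma L2T_integrable (R : realType) (g : R -> R) :
  L2T g -> mu.-integrable `[- pi, pi] (EFin \o g).
Proof.
move=> [mg g2i].
have H : mu.-integrable `[- pi, pi] (EFin \o (fun x : R => g x ^+ 2 + 1)).
  by apply: integrable_EFinD => //; exact: integrable_cst.
apply: le_integrable H => //.
- exact/measurable_EFinP.
- move=> x _ /=; rewrite lee_fin [leRHS]ger0_norm; last by rewrite addr_ge0// sqr_ge0.
  by rewrite -[g x ^+ 2]real_normK ?num_real//; move: `|g x| => y; have := sqr_ge0 (y - 2^-1); nra.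
Qed.

(** The pointwise inequality [y <= l y ^ 2 + 1 / l] stands in for Cauchy-Schwarz; the free parameter
    [l] lets a small L^2 norm force a small L^1 norm. *)
Lemma L2T_Rintegral_norm_le (R : realType) (g : R -> R) (l : R) : 0 < l -> L2T g ->
  \int[mu]_(x in `[- pi, pi]) `|g x| <=
  l * \int[mu]_(x in `[- pi, pi]) g x ^+ 2 + l^-1 * (2 * pi).
Proof.
move=> l0 Lg; have gi := @L2T_integrable R g Lg; case: Lg => mg g2i.
have g2i' : mu.-integrable `[- pi, pi] (EFin \o (fun x => g x ^+ 2)) by [].
rewrite -RintegralZl// -Rintegral_cst_pi.
have li := @integrable_EFinZ R _ _ l _ g2i'.
rewrite -RintegralD//; last exact: integrable_cst.
apply: le_Rintegral => //.
- exact: integrable_norm gi.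
- by apply: integrable_EFinD => //; exact: integrable_cst.
- move=> x _; rewrite -[g x ^+ 2]real_normK ?num_real//.
  move: `|g x| => y; rewrite -subr_ge0.
  have -> : l * y ^+ 2 + l^-1 - y = l * ((y - (l^-1 / 2)) ^+ 2) + l^-1 * (3 / 4).
    by field; rewrite gt_eqF.
  by rewrite addr_ge0// mulr_ge0 ?sqr_ge0 ?(ltW l0) ?invr_ge0 ?(ltW l0)//; lra.
Qed.

Lemma L2T_norm_small (R : realType) (e : R) : 0 < e -> exists2 m : R, 0 < m &
  forall g : R -> R, L2T g ->
    (\int[mu]_(x in @Tdom R) ((g x) ^+ 2)%:E < m%:E)%E ->
    \int[mu]_(x in `[- pi, pi]) `|g x| <= e.
Proof.
move=> e0; have pi0 := pi_gt0 R.
(* This [l] makes [2 pi / l] equal to [e / 2], and the bound [e / 2 / l] on the squared norm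
   supplies the other half. *)
pose l := 4 * pi / e; have l0 : 0 < l by rewrite divr_gt0// mulr_gt0.
exists (e / 2 / l); first by rewrite divr_gt0// divr_gt0.
move=> g Lg gm; apply: (le_trans (@L2T_Rintegral_norm_le R g l l0 Lg)).
have {}gm : \int[mu]_(x in `[- pi, pi]) g x ^+ 2 <= e / 2 / l.
  apply: ltW; rewrite -lte_fin fineK//.
  by apply: integrable_fin_num => //; case: Lg.
rewrite [leRHS](_ : _ = l * (e / 2 / l) + l^-1 * (2 * pi)); last first.
  have pin0 : pi != 0 :> R by rewrite gt_eqF.
  have en0 : e != 0 by rewrite gt_eqF.
  by rewrite /l; move: (pi : R) pin0 => p p0; field; rewrite en0.
by rewrite lerD2r ler_pM2l.
Qed.

Lemma test_fun_continuous (R : realType) (phi : R -> R) : test_fun phi -> continuous phi.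
Proof.
move=> [_ dphi] x; apply/differentiable_continuous/derivable1_diffP.
exact: (dphi 0%N x).
Qed.

(** In one dimension an integrable third weak derivative already gives two continuous classical
    ones. The condition is linear in the pair, so it passes to differences of time slices. *)
Definition weak_third (R : realType) (f D : R -> R) : Prop :=
  mu.-integrable `[- pi, pi] (EFin \o D) /\
  forall phi, test_fun phi ->
    \int[mu]_(x in `[- pi, pi]) (f x * derive1n 3 phi x) =
    - \int[mu]_(x in `[- pi, pi]) (D x * phi x).

Lemma H5_derivs_weak_third (R : realType) (f : R -> R) (D : nat -> R -> R) :
  H5_derivs f D -> weak_third R f (D 3%N).
Proof.
move=> [_ /(_ 3%N isT)[LD wD]]; have Di := @L2T_integrable R _ LD; split=> // phi tphi.
have := wD phi tphi => /(congr1 fine).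
have Dphi : mu.-integrable `[- pi, pi] (EFin \o (fun x => D 3%N x * phi x)).
  apply: integrable_mulr_continuous => //.
  exact/continuous_subspaceT/test_fun_continuous.
rewrite fineM//; last exact: integrable_fin_num Dphi.
by rewrite /Rintegral => -> /=; rewrite -signr_odd/= expr1 mulN1r.
Qed.

Lemma weak_third_sub (R : realType) (f g D E : R -> R) : continuous f -> continuous g ->
  weak_third R f D -> weak_third R g E ->
  weak_third R (fun x => f x - g x) (fun x => D x - E x).
Proof.
move=> cf cg [Di fD] [Ei gE]; split; first exact: integrable_EFinB.
move=> phi tphi.
have wphi : {within `[- pi, pi], continuous phi} := continuous_subspaceT (test_fun_continuous R _ tphi).
have wphi3 : {within `[- pi, pi], continuous (derive1n 3 phi)}.
  apply: continuous_subspaceT => x; apply/differentiable_continuous/derivable1_diffP.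
  by case: tphi => _; exact.
have fi := @within_continuous_integrable R (- pi) pi _ (continuous_subspaceT cf).
have gi := @within_continuous_integrable R (- pi) pi _ (continuous_subspaceT cg).
transitivity (\int[mu]_(x in `[- pi, pi]) (f x * derive1n 3 phi x - g x * derive1n 3 phi x)).
  by apply: eq_Rintegral => x _; rewrite mulrBl.
rewrite RintegralB//; [|exact: integrable_mulr_continuous..].
rewrite fD// gE// -opprD; congr (- _).
rewrite -RintegralB//; [|exact: integrable_mulr_continuous..].
by apply: eq_Rintegral => x _; rewrite mulrBl.
Qed.

Lemma in_oo_nbhs (R : realType) (a b x : R) : x \in `]a, b[ -> \forall y \near x, y \in `]a, b[.
Proof. by move=> xI; exact: near_in_itvoo. Qed.

Lemma subset_itv_oo_cc_mem (R : realType) (a b x : R) : x \in `]a, b[ -> x \in `[a, b].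
Proof. exact: subset_itv_oo_cc. Qed.

(** A quantitative Sobolev embedding. Each primitive costs a factor 2, and each integration over the
    period a factor [2 pi]: this produces 2, [8 pi] and [32 pi ^ 2] for the three levels, while
    [1 / (2 pi)] comes from the mean of [f]. [C] is simply their sum. *)
Lemma weak_third_C2 (R : realType) (f D : R -> R) : continuous f -> weak_third R f D ->
  let g2 := zero_mean_primitive R D in let g1 := zero_mean_primitive R g2 in
  let N := \int[mu]_(t in `[- pi, pi]) `|D t| + \int[mu]_(t in `[- pi, pi]) `|f t| in
  let C := 2 + 8 * pi + 32 * pi ^+ 2 + (2 * pi)^-1 in
  forall x, x \in `]- pi, pi[ ->
  [/\ is_derive x 1 f (g1 x), is_derive x 1 g1 (g2 x), {for x, continuous g2} &
      [/\ `|f x| <= C * N, `|g1 x| <= C * N & `|g2 x| <= C * N]].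
Proof.
move=> cf [Di fD] g2 g1 N C x xI.
have xI' := @subset_itv_oo_cc_mem R _ _ x xI.
have g2i : mu.-integrable `[- pi, pi] (EFin \o g2) := integrable_zero_mean_primitive R _ Di.
have g1i : mu.-integrable `[- pi, pi] (EFin \o g1) := integrable_zero_mean_primitive R _ g2i.
have cg2 : {within `[- pi, pi], continuous g2} := zero_mean_primitive_continuous R _ Di.
have cg1 : {within `[- pi, pi], continuous g1} := zero_mean_primitive_continuous R _ g2i.
have fE y : y \in `]- pi, pi[ -> f y = _ := weak_deriv3_regular R f D y cf Di fD.
pose ND := \int[mu]_(t in `[- pi, pi]) `|D t|.
pose Nf := \int[mu]_(t in `[- pi, pi]) `|f t|.
have ND0 : 0 <= ND by exact: Rintegral_ge0.
have Nf0 : 0 <= Nf by exact: Rintegral_ge0.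
have pi0 := pi_gt0 R.
have B2 y : y \in `[- pi, pi] -> `|g2 y| <= 2 * ND.
  by move=> yI; exact: zero_mean_primitive_le.
have itv0 (h : R -> R) (M : R) : mu.-integrable `[- pi, pi] (EFin \o h) ->
    (forall y, y \in `[- pi, pi] -> `|h y| <= M) ->
    \int[mu]_(t in `[- pi, pi]) `|h t| <= M * (2 * pi).
  move=> hi hM; rewrite -Rintegral_cst_pi; apply: le_Rintegral => //.
  - exact: integrable_norm hi.
  - exact: integrable_cst.
have B1 y : y \in `[- pi, pi] -> `|g1 y| <= 8 * pi * ND.
  move=> yI; apply: (le_trans (@zero_mean_primitive_le R g2 y yI g2i)).
  by apply: (@le_trans _ _ (2 * (2 * ND * (2 * pi)))); [rewrite ler_pM2l// itv0|lra].
have B0 y : y \in `[- pi, pi] -> `|zero_mean_primitive R g1 y| <= 32 * pi ^+ 2 * ND.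
  move=> yI; apply: (le_trans (@zero_mean_primitive_le R g1 y yI g1i)).
  apply: (@le_trans _ _ (2 * (8 * pi * ND * (2 * pi)))); first by rewrite ler_pM2l// itv0.
  by rewrite le_eqVlt; apply/orP; left; apply/eqP; ring.
have p2 : 0 < (2 * pi)^-1 :> R by rewrite invr_gt0 mulr_gt0.
have pp : 0 <= pi ^+ 2 :> R by exact: sqr_ge0.
have CN : [/\ 2 * ND <= C * N, 8 * pi * ND <= C * N &
    32 * pi ^+ 2 * ND + (2 * pi)^-1 * Nf <= C * N].
  have aux (p q r A B : R) : 0 < p -> 0 < q -> 0 <= r -> 0 <= A -> 0 <= B ->
      [/\ 2 * A <= (2 + 8 * p + 32 * r + q) * (A + B),
      8 * p * A <= (2 + 8 * p + 32 * r + q) * (A + B) &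
      32 * r * A + q * B <= (2 + 8 * p + 32 * r + q) * (A + B)].
    clear => p0 q0 r0 A0 B0.
    have := mulr_ge0 (ltW p0) A0; have := mulr_ge0 (ltW p0) B0.
    have := mulr_ge0 (ltW q0) A0; have := mulr_ge0 (ltW q0) B0.
    have := mulr_ge0 r0 A0; have := mulr_ge0 r0 B0.
    by move=> *; split; lra.
  exact: aux.
case: CN => CN2 CN1 CN0; split.
- have := @is_derive_zero_mean_primitive R g1 x cg1 xI => H.
  have H' : is_derive x 1 (fun y => zero_mean_primitive R g1 y +
      (2 * pi)^-1 * \int[mu]_(x in `[- pi, pi]) f x) (g1 x).
    by rewrite -[g1 x]addr0; exact: (is_deriveD H (is_derive_cst _ _ _)).
  apply: near_eq_is_derive H'.
  by near=> y; apply/esym/fE; near: y; exact: in_oo_nbhs.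
- exact: is_derive_zero_mean_primitive.
- exact: within_continuous_in.
split.
- rewrite fE//; apply: le_trans CN0; apply: (le_trans (ler_normD _ _)).
  rewrite lerD ?B0// normrM gtr0_norm// ler_pM2l//; apply: le_normr_Rintegral => //.
  exact: (@within_continuous_integrable R (- pi) pi _ (continuous_subspaceT cf)).
- exact: le_trans (B1 x xI') CN1.
- exact: le_trans (B2 x xI') CN2.
Unshelve. all: by end_near. Qed.

(** Continuity in time with values in C^2, with the derivatives carried as data. The modulus [d]
    does not depend on [x], which is what later gives joint limits in time and space; the open
    period suffices because the study is local at the origin. *)
Definition C2_path (R : realType) (t0 : R) (u u1 u2 : R -> R -> R) : Prop :=
  forall t, 0 <= t < t0 ->
  (forall x : R, x \in `]- pi, pi[ ->
     [/\ is_derive x 1 (u t) (u1 t x), is_derive x 1 (u1 t) (u2 t x) &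
         {for x, continuous (u2 t)}]) /\
  (exists M : R, forall x, x \in `]- pi, pi[ ->
     [/\ `|u t x| <= M, `|u1 t x| <= M & `|u2 t x| <= M]) /\
  forall e : R, 0 < e -> exists2 d : R, 0 < d &
    forall s, 0 <= s < t0 -> `|s - t| < d -> forall x, x \in `]- pi, pi[ ->
    [/\ `|u s x - u t x| <= e, `|u1 s x - u1 t x| <= e & `|u2 s x - u2 t x| <= e].

Lemma is_derive_near_unique (R : realType) (f g : R -> R) (df dg x : R) :
  (\forall y \near x, f y = g y) -> is_derive x 1 f df -> is_derive x 1 g dg -> df = dg.
Proof.
move=> fg Df Dg; have Dg' := near_eq_is_derive fg Df.
by rewrite -(@derive_val _ _ _ _ _ _ _ Dg') -(@derive_val _ _ _ _ _ _ _ Dg).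
Qed.

Lemma L2T_sub (R : realType) (f g : R -> R) : L2T f -> L2T g -> L2T (fun x => f x - g x).
Proof.
move=> [mf fi] [mg gi]; split; first exact: measurable_funB.
have H : mu.-integrable `[- pi, pi] (EFin \o (fun x : R => 2 * (f x ^+ 2 + g x ^+ 2))).
  by apply: integrable_EFinZ; apply: integrable_EFinD.
apply: le_integrable H => //.
- apply/measurable_EFinP; apply: measurable_funX; exact: measurable_funB.
- move=> x _ /=; rewrite lee_fin.
  rewrite (ger0_norm (sqr_ge0 _)) ger0_norm ?mulr_ge0 ?addr_ge0 ?sqr_ge0//.
  by have := sqr_ge0 (f x + g x); nra.
Qed.

Lemma C_H5_C2_path (R : realType) (t0 : R) (u : R -> R -> R) : C_H5 t0 u ->
  exists u1 u2, C2_path R t0 u u1 u2.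
Proof.
move=> [D [uD Dcont]].
exists (fun t => zero_mean_primitive R (zero_mean_primitive R (D 3%N t))),
  (fun t => zero_mean_primitive R (D 3%N t)) => t t0t.
have [_ [cut Ht]] := uD t t0t; have wt := @H5_derivs_weak_third R _ _ Ht.
have Ct := @weak_third_C2 R _ _ cut wt.
split; first by move=> x xI; have [D1 D2 c2 _] := Ct x xI.
split; first by eexists => x xI; have [_ _ _] := Ct x xI; exact.
move=> e e0.
pose C : R := 2 + 8 * pi + 32 * pi ^+ 2 + (2 * pi)^-1.
have C0 : 0 < C.
  by rewrite !addr_gt0// ?mulr_gt0// ?invr_gt0 ?mulr_gt0 ?pi_gt0// exprn_gt0// pi_gt0.
have eC : 0 < e / C / 2 by rewrite divr_gt0// divr_gt0.
have [m m0 Hm] := @L2T_norm_small R _ eC.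
have [d0 d00 Hd0] := Dcont 0%N isT t t0t m m0.
have [d3 d30 Hd3] := Dcont 3%N isT t t0t m m0.
exists (Num.min d0 d3); first by rewrite lt_min d00.
move=> s t0s; rewrite lt_min => /andP[sd0 sd3] x xI.
have [_ [cus Hs]] := uD s t0s; have ws := @H5_derivs_weak_third R _ _ Hs.
have Cs := @weak_third_C2 R _ _ cus ws.
(* The embedding is applied to the difference of the slices, so its bound by L^1 norms becomes
   continuity in time. *)
pose f y := u s y - u t y; pose E y := D 3%N s y - D 3%N t y.
have cf : continuous f by move=> y; apply: cvgB; [exact: cus|exact: cut].
have wf : weak_third R f E by exact: weak_third_sub.
have Cf := @weak_third_C2 R f E cf wf.
(* The primitives of [E] are identified with differences of primitives by uniqueness of derivatives,
   first at level one and then, from that, at level two. *)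
have f1E y : y \in `]- pi, pi[ -> zero_mean_primitive R (zero_mean_primitive R E) y =
    zero_mean_primitive R (zero_mean_primitive R (D 3%N s)) y -
    zero_mean_primitive R (zero_mean_primitive R (D 3%N t)) y.
  move=> yI; have [Df _ _ _] := Cf y yI; have [Ds _ _ _] := Cs y yI.
  have [Dt _ _ _] := Ct y yI.
  apply: (@is_derive_near_unique R f f _ _ y _ Df (is_deriveB Ds Dt)).
  by near=> z.
have f2E y : y \in `]- pi, pi[ -> zero_mean_primitive R E y =
    zero_mean_primitive R (D 3%N s) y - zero_mean_primitive R (D 3%N t) y.
  move=> yI; have [_ Df _ _] := Cf y yI; have [_ Ds _ _] := Cs y yI.
  have [_ Dt _ _] := Ct y yI.
  apply: (@is_derive_near_unique R _ _ _ _ y _ Df (is_deriveB Ds Dt)).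
  by near=> z; apply: f1E; near: z; exact: in_oo_nbhs.
have [_ _ _ [B0 B1 B2]] := Cf x xI.
rewrite -/C in B0 B1 B2; rewrite (f1E x xI) in B1; rewrite (f2E x xI) in B2.
have Ls j : (j <= 5)%N -> L2T (D j s) by move=> j5; case: Hs => _ /(_ j j5)[].
have Lt j : (j <= 5)%N -> L2T (D j t) by move=> j5; case: Ht => _ /(_ j j5)[].
have NE : \int[mu]_(y in `[- pi, pi]) `|E y| <= e / C / 2.
  by apply: Hm; [apply: L2T_sub; [exact: Ls|exact: Lt]|exact: Hd3].
have Nf : \int[mu]_(y in `[- pi, pi]) `|f y| <= e / C / 2.
  have fE : f = (fun y => D 0%N s y - D 0%N t y).
    by case: Hs => [-> _]; case: Ht => [-> _].
  rewrite fE; apply: Hm; [apply: L2T_sub; [exact: Ls|exact: Lt]|exact: Hd0].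
have CN : C * (\int[mu]_(y in `[- pi, pi]) `|E y| + \int[mu]_(y in `[- pi, pi]) `|f y|) <= e.
  by rewrite mulrC -ler_pdivlMr// [leRHS]splitr lerD.
by split; [apply: le_trans B0 CN|apply: le_trans B1 CN|apply: le_trans B2 CN].
Unshelve. all: by end_near. Qed.

(** * The pointwise equations *)

(** With [q x = 0], the slope function of [q] multiplied by [p] is a slope function of the product,
    so mere continuity of [p] is enough. *)
Lemma is_derive_mul_vanishing (R : realType) (p q : R -> R) (x dq : R) :
  {for x, continuous p} -> is_derive x 1 q dq -> q x = 0 ->
  is_derive x 1 (fun y => p y * q y) (p x * dq).
Proof.
move=> cp /is_derive1_caratheodory[g [gE cg gx]] q0.
apply/is_derive1_caratheodory; exists (fun z => p z * g z); split.
- by move=> z; rewrite q0 mulr0 subr0 -mulrA -gE q0 subr0.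
- by apply: cvgM; [exact: cp|exact: cg].
- by rewrite gx.
Qed.

Lemma is_derive_continuous (R : realType) (f : R -> R) (x df : R) :
  is_derive x 1 f df -> {for x, continuous f}.
Proof. by move=> [D _]; exact/differentiable_continuous/derivable1_diffP. Qed.

Lemma powR_le_self (R : realType) (r z : R) : 1 <= r -> 0 <= z <= 1 -> powR z r <= z.
Proof.
move=> r1 /andP[z0 z1]; move: z0; rewrite le_eqVlt => /predU1P[<-|z0].
  by rewrite powR0// gt_eqF// (lt_le_trans ltr01).
by apply: ge1r_powR => //; rewrite z0.
Qed.

Lemma powR_cvg_0 (R : realType) (T : Type) (F : set_system T) {FF : ProperFilter F}
    (f : T -> R) (r : R) : 1 <= r -> (\forall x \near F, 0 <= f x) ->
  f x @[x --> F] --> 0 -> powR (f x) r @[x --> F] --> 0.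
Proof.
move=> r1 f0 fcvg; apply: (@squeeze_cvgr _ _ _ _ (fun=> 0) f) => //; last exact: cvg_cst.
have /cvgrPdist_le/(_ 1 ltr01) := fcvg; apply: filterS2 f0 => x f0.
by rewrite sub0r normrN ger0_norm// => f1; rewrite powR_ge0 powR_le_self// f0.
Qed.

(** Where [w x > 0] this is the chain and product rule. At a zero of [w] the power need not be
    differentiable, but [w1] vanishes too, so its continuity is enough; the first term of the value
    is then 0 even for [r = 1], where [powR 0 0] is 1. *)
Lemma is_derive_powR_flux (R : realType) (w w1 : R -> R) (x w2 r : R) :
  1 <= r -> (forall y, 0 <= w y) -> is_derive x 1 w (w1 x) -> is_derive x 1 w1 w2 ->
  (w x = 0 -> w1 x = 0) ->
  is_derive x 1 (fun y => powR (w y) r * w1 y)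
    (r * powR (w x) (r - 1) * w1 x ^+ 2 + powR (w x) r * w2).
Proof.
move=> r1 w0 Dw Dw1 w10; have cw := @is_derive_continuous R _ _ _ Dw.
have := w0 x; rewrite le_eqVlt => /predU1P[wx0|wx0].
  have wx : w x = 0 by rewrite -wx0.
  rewrite (w10 wx) expr0n/= mulr0 add0r.
  apply: (@is_derive_mul_vanishing R (fun y => powR (w y) r)) => //; last exact: w10.
  have cw0 : w y @[y --> x] --> 0 by move: cw; rewrite /prop_for /continuous_at wx.
  have w0n : \forall y \near x, 0 <= w y by apply: filterE.
  have cp0 := @powR_cvg_0 R _ _ _ w r r1 w0n cw0.
  have r0 : r != 0 by rewrite gt_eqF// (lt_le_trans ltr01).
  suff : powR (w y) r @[y --> x] --> powR (w x) r by [].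
  by rewrite wx powR0//; exact: cp0.
have Dr : is_derive (w x) 1 (fun z => powR z r) (r * powR (w x) (r - 1)) by exact: is_derive1_powR.
have Dp := is_derive1_comp Dr Dw.
have := is_deriveM Dp Dw1.
rewrite /comp => H; apply: is_derive_eq H _.
by rewrite /GRing.scale/= addrC; ring.
Qed.

Lemma nonneg_zero_derive (R : realType) (f f1 : R -> R) (r x : R) :
  (forall y : R, y \in `]- r, r[ -> is_derive y 1 f (f1 y)) -> x \in `]- r, r[ ->
  (forall y, 0 <= f y) -> f x = 0 -> f1 x = 0.
Proof.
move=> Df xI f0 fx; rewrite -(@derive_val _ _ _ _ _ _ _ (Df x xI)).
apply: (@derive_val _ _ _ _ _ _ _ (@derive1_at_min R f (- r) r x _ _ xI _)).
- by move: xI; rewrite in_itv/= => /andP[r1 r2]; rewrite ltW// (lt_trans r1).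
- by move=> y /Df[].
- by move=> y _; rewrite fx.
Qed.

(** The right-hand side of the equation for [w], with the derivative of the flux [w ^ beta * w_x]
    expanded. *)
Definition w_speed {R : realType} (kappa alpha beta w w1 w2 v1 : R) : R :=
  kappa * (beta * powR w (beta - 1) * w1 ^+ 2 + powR w beta * w2) + powR w alpha * v1 ^+ 2.

(** The [v] equation is extracted for [alpha = 1] only: there the flux is [w * v1], and the plain
    product rule expands it. *)
Lemma classical_solution_pointwise (R : realType) (kappa alpha beta t0 : R) (v0 w0 : R -> R)
    (v w : R -> R -> R) : 1 <= alpha -> 1 <= beta ->
  classical_solution kappa alpha beta v0 w0 t0 v w ->
  exists v1 v2 w1 w2 : R -> R -> R,
  [/\ C2_path R t0 v v1 v2, C2_path R t0 w w1 w2,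
      forall t x, 0 < t < t0 -> x \in `]- pi, pi[ ->
        is_derive t 1 (fun s => w s x)
          (w_speed kappa alpha beta (w t x) (w1 t x) (w2 t x) (v1 t x)) &
      alpha = 1 -> forall t x, 0 < t < t0 -> x \in `]- pi, pi[ ->
        is_derive t 1 (fun s => v s x) (w1 t x * v1 t x + w t x * v2 t x)].
Proof.
move=> a1 b1 [/C_H5_C2_path[v1 [v2 Cv]] [/C_H5_C2_path[w1 [w2 Cw]] [_ [_ [wpos PDE]]]]].
have tw t : 0 < t < t0 -> 0 <= t < t0 by move=> /andP[/ltW -> ->].
have wmin t x : 0 < t < t0 -> x \in `]- pi, pi[ -> w t x = 0 -> w1 t x = 0.
  move=> tt xI; have [Dw _] := Cw t (tw t tt).
  apply: (@nonneg_zero_derive R _ _ pi) => //; first by move=> y /Dw[].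
  by move=> y; exact/wpos/tw.
have dxE (u u1 u2 : R -> R -> R) : C2_path R t0 u u1 u2 -> forall t x, 0 < t < t0 ->
    x \in `]- pi, pi[ -> dx u t x = u1 t x.
  move=> Cu t x tt xI; have [/(_ x xI)[Dx _ _] _] := Cu t (tw t tt).
  by rewrite /dx derive1E; exact: (@derive_val _ _ _ _ _ _ _ Dx).
have fluxE (u u1 u2 : R -> R -> R) r t x df : C2_path R t0 u u1 u2 -> 0 < t < t0 ->
    x \in `]- pi, pi[ -> is_derive x 1 (fun y => powR (w t y) r * u1 t y) df ->
    derive1 (fun y => powR (w t y) r * dx u t y) x = df.
  move=> Cu tt xI Df; rewrite derive1E; apply: derive_val.
  apply: near_eq_is_derive Df.
  by near=> y; rewrite (dxE u u1 u2)//; near: y; exact: in_oo_nbhs.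
exists v1, v2, w1, w2; split => //.
- move=> t x tt xI; have [_ [dwt [_ [_ [_ [_ [_ eqw]]]]]]] := PDE t x tt.
  have [/(_ x xI)[Dw Dw1 _] _] := Cw t (tw t tt).
  have DF := @is_derive_powR_flux R (w t) (w1 t) x (w2 t x) beta b1
    (fun y => wpos t y (tw t tt)) Dw Dw1 (wmin t x tt xI).
  rewrite (fluxE w w1 w2 beta t x _ Cw tt xI DF) (dxE v v1 v2 Cv t x tt xI) in eqw.
  apply: DeriveDef => //; rewrite -derive1E -/(dt w t x) /w_speed -eqw addrC subrK//.
- move=> al t x tt xI; have [dvt [_ [_ [_ [_ [_ [eqv _]]]]]]] := PDE t x tt.
  have [/(_ x xI)[Dw _ _] _] := Cw t (tw t tt).
  have [/(_ x xI)[_ Dv1 _] _] := Cv t (tw t tt).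
  have DF : is_derive x 1 (fun y => powR (w t y) alpha * v1 t y)
      (w1 t x * v1 t x + w t x * v2 t x).
    rewrite al; under eq_fun do rewrite powRr1 ?wpos ?tw//.
    have H := is_deriveM Dw Dv1; apply: is_derive_eq H _.
    by rewrite /GRing.scale/= addrC; ring.
  rewrite (fluxE v v1 v2 alpha t x _ Cv tt xI DF) in eqv.
  by apply: DeriveDef => //; rewrite -derive1E -/(dt v t x); apply/eqP; rewrite -subr_eq0 eqv.
Unshelve. all: by end_near. Qed.

(** * Persistence of the zero at the origin *)

Lemma MVT_ball (R : realType) (f f1 : R -> R) (a r x : R) :
  (forall y : R, `|y - a| < r -> is_derive y 1 f (f1 y)) -> `|x - a| < r ->
  exists2 c : R, `|c - a| <= `|x - a| & f x - f a = f1 c * (x - a).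
Proof.
move=> Df xr.
have sub (p q : R) : `|p - a| <= `|x - a| -> `|q - a| <= `|x - a| -> p <= q ->
    exists2 c : R, `|c - a| <= `|x - a| & f q - f p = f1 c * (q - p).
  move=> pr qr pq.
  have yI (y : R) : p <= y <= q -> `|y - a| <= `|x - a|.
    move: pr qr => /[!ler_norml] /andP[p1 p2] /andP[q1 q2] /andP[y1 y2].
    by rewrite (le_trans p1) ?lerD2r//= (le_trans _ q2)// lerD2r.
  have H1 (y : R) : y \in `]p, q[ -> is_derive y 1 f (f1 y).
    rewrite in_itv/= => /andP[y1 y2]; apply/Df/(le_lt_trans _ xr)/yI.
    by rewrite !ltW.
  have H2 : {within `[p, q], continuous f}.
    apply: derivable_within_continuous => y; rewrite in_itv/= => /yI yx.
    by have /Df[] := le_lt_trans yx xr.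
  have [c cI E] := MVT_segment pq H1 H2.
  by exists c => //; apply: yI; rewrite in_itv in cI.
have a0 : `|a - a| <= `|x - a| by rewrite subrr normr0.
have [ax|xa] := leP a x; first exact: sub.
have [c cI E] := sub x a (lexx _) a0 (ltW xa).
by exists c => //; rewrite -opprB E -mulrN opprB.
Qed.

Lemma MVT_origin (R : realType) (f f1 : R -> R) (r x : R) :
  (forall y : R, y \in `]- r, r[ -> is_derive y 1 f (f1 y)) -> x \in `]- r, r[ ->
  exists2 c : R, `|c| <= `|x| & f x - f 0 = f1 c * x.
Proof.
move=> Df; rewrite in_itv/= -ltr_norml => xr.
have Df0 (y : R) : `|y - 0| < r -> is_derive y 1 f (f1 y).
  by rewrite subr0 => yr; apply: Df; rewrite in_itv/= -ltr_norml.
have := @MVT_ball R f f1 0 r x Df0; rewrite !subr0 => /(_ xr)[c].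
by rewrite subr0 => cx E; exists c.
Qed.

(** Multiplied by the integrating factor [expR (- L * t)], [g] becomes nonincreasing. *)
Lemma gronwall_le0 (R : realType) (g dg : R -> R) (L T : R) : 0 <= T ->
  {within `[0, T], continuous g} ->
  (forall t : R, t \in `]0, T[ -> is_derive t 1 g (dg t)) ->
  (forall t, t \in `]0, T[ -> dg t <= L * g t) -> g 0 <= 0 -> g T <= 0.
Proof.
move=> T0 cg Dg dgL g0.
pose h t := expR (- L * t) * g t.
have De (t : R) : is_derive t 1 (fun t => expR (- L * t)) (- L * expR (- L * t)).
  have H : is_derive t 1 (fun y : R => - L * y) (- L).
    by apply: is_derive_eq; exact: mulr1.
  by have := is_derive1_comp (is_derive_expR (- L * t)) H; rewrite mulrC.
have Dh t : t \in `]0, T[ -> is_derive t 1 h (expR (- L * t) * (dg t - L * g t)).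
  move=> tI; have H := is_deriveM (De t) (Dg t tI); apply: is_derive_eq H _.
  by rewrite /GRing.scale/=; ring.
have H1 t : t \in `]0, T[ -> derivable h t 1 by move=> /Dh[].
have H2 t : t \in `]0, T[ -> derive1 h t <= 0.
  move=> tI; rewrite derive1E (@derive_val _ _ _ _ _ _ _ (Dh t tI)).
  by rewrite pmulr_rle0 ?expR_gt0// subr_le0 dgL.
have H3 : {within `[0, T], continuous h}.
  move=> t; apply: cvgM; last exact: cg.
  by apply: continuous_subspaceT => y; exact: (@is_derive_continuous R _ y _ (De y)).
have I0 : 0 \in `[0, T] by rewrite in_itv/= lexx.
have IT : T \in `[0, T] by rewrite in_itv/= lexx andbT.
have hle : h T <= h 0 := ler0_derive1_le_cc H1 H2 H3 IT I0 T0.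
move: hle; rewrite /h mulr0 expR0 mul1r => hle.
by have := le_trans hle g0; rewrite pmulr_rle0// expR_gt0.
Qed.

(** A bound [M] at one time is a bound [M + 1] at neighbouring times, and compactness of the segment
    makes it global. *)
Lemma C2_path_bounded (R : realType) (t0 T : R) (u u1 u2 : R -> R -> R) :
  C2_path R t0 u u1 u2 -> T < t0 ->
  exists2 M : R, 1 <= M & forall s x, 0 <= s <= T -> x \in `]- pi, pi[ ->
    [/\ `|u s x| <= M, `|u1 s x| <= M & `|u2 s x| <= M].
Proof.
move=> Cu Tt0.
pose P (M s : R) := forall x, x \in `]- pi, pi[ ->
    [/\ `|u s x| <= M, `|u1 s x| <= M & `|u2 s x| <= M].
have : \forall M \near +oo, `[0, T]%classic `<=` P M.
  apply: (near_covering_withinP _).2; first exact/compact_near_coveringP/segment_compact.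
  move=> t /=; rewrite in_itv/= => /andP[t0' tT].
  have tI : 0 <= t < t0 by rewrite t0' (le_lt_trans tT).
  have [_ [[M HM] /(_ 1 ltr01)[d d0 Hd]]] := Cu t tI.
  exists (ball t d, [set N | M + 1 <= N]) => /=.
    by split; [exact: nbhsx_ballx|apply: nbhs_pinfty_ge; exact: num_real].
  move=> [s N] /= [sd MN]; rewrite in_itv/= => /andP[s0 sT] x xI.
  have sI : 0 <= s < t0 by rewrite s0 (le_lt_trans sT).
  have sd' : `|s - t| < d by rewrite distrC.
  have [A0 A1 A2] := Hd s sI sd' x xI; have [B0 B1 B2] := HM x xI.
  have tri (a b : R) : `|a - b| <= 1 -> `|b| <= M -> `|a| <= N.
    move=> ab bM; apply: le_trans MN; rewrite -[a](subrK b) addrC.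
    by apply: (le_trans (ler_normD _ _)); rewrite lerD.
  by split; [exact: tri A0 B0|exact: tri A1 B1|exact: tri A2 B2].
move=> [N [_ HN]].
exists (Num.max (N + 1) 1); first by rewrite le_max lexx orbT.
move=> s x sT xI; apply: (HN (Num.max (N + 1) 1)) => //.
by rewrite lt_max ltrDl ltr01.
Qed.

Lemma C2_path_continuous (R : realType) (t0 T x : R) (u u1 u2 : R -> R -> R) :
  C2_path R t0 u u1 u2 -> T < t0 -> x \in `]- pi, pi[ ->
  [/\ {within `[0, T], continuous (fun s => u s x)},
      {within `[0, T], continuous (fun s => u1 s x)} &
      {within `[0, T], continuous (fun s => u2 s x)}].
Proof.
move=> Cu Tt0 xI.
have gen (g : R -> R) : (forall t e, 0 <= t < t0 -> 0 < e -> exists2 d, 0 < d &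
    forall s, 0 <= s < t0 -> `|s - t| < d -> `|g s - g t| <= e) ->
    {within `[0, T], continuous g}.
  move=> H; apply/subspace_continuousP => t; rewrite /= in_itv/= => /andP[t0' tT].
  have tI : 0 <= t < t0 by rewrite t0' (le_lt_trans tT).
  apply/cvgrPdist_le => e e0; have [d d0 Hd] := H t e tI e0.
  apply/nbhs_ballP; exists d => //= s; rewrite /ball/= => st; rewrite in_itv/= => /andP[s0 sT].
  by rewrite distrC; apply: Hd; [rewrite s0 (le_lt_trans sT)|rewrite distrC].
by split; apply: gen => t e tI e0; have [_ [_ /(_ e e0)[d d0 Hd]]] := Cu t tI;
  exists d => // s sI st; have [] := Hd s sI st x xI.
Qed.

Lemma zero_in_pi (R : realType) : (0 : R) \in `]- pi, pi[.
Proof. by rewrite in_itv/= oppr_lt0 pi_gt0. Qed.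

(** Two uses of the mean value theorem give the remainder with constant 1 in place of the sharp 1/2,
    hence the 4 in the bound on the squared derivative below. *)
Lemma taylor_origin (R : realType) (f f1 f2 : R -> R) (r M h : R) :
  (forall y : R, y \in `]- r, r[ -> is_derive y 1 f (f1 y)) ->
  (forall y : R, y \in `]- r, r[ -> is_derive y 1 f1 (f2 y)) ->
  (forall y : R, y \in `]- r, r[ -> `|f2 y| <= M) -> h \in `]- r, r[ ->
  `|f h - f 0 - f1 0 * h| <= M * h ^+ 2.
Proof.
move=> D1 D2 fM hI.
have [c ch E] := @MVT_origin R f f1 r h D1 hI.
have sub y : `|y| <= `|h| -> y \in `]- r, r[.
  move=> yh; have hr : `|h| < r by move: hI; rewrite in_itv/= ltr_norml.
  by rewrite in_itv/= -ltr_norml (le_lt_trans yh).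
have [d dc E'] := @MVT_origin R f1 f2 r c D2 (sub c ch).
have -> : f h - f 0 - f1 0 * h = f2 d * c * h by rewrite E -mulrBl E'.
rewrite -[h ^+ 2]real_normK ?num_real// !normrM expr2 mulrA.
rewrite ler_wpM2r// ler_pM//; exact: fM (sub d (le_trans dc ch)).
Qed.

Lemma nonneg_derivative_sqr_le (R : realType) (f f1 f2 : R -> R) (M : R) : 0 < M ->
  (forall y : R, y \in `]- pi, pi[ -> is_derive y 1 f (f1 y)) ->
  (forall y : R, y \in `]- pi, pi[ -> is_derive y 1 f1 (f2 y)) ->
  (forall y : R, y \in `]- pi, pi[ -> `|f2 y| <= M) -> `|f1 0| <= M ->
  (forall y, 0 <= f y) -> f1 0 ^+ 2 <= 4 * M * f 0.
Proof.
move=> M0 D1 D2 fM f1M f0.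
(* This [h] minimises the Taylor majorant [f 0 + f1 0 * h + M * h ^ 2], whose value there is
   [f 0 - f1 0 ^ 2 / (4 M)]. The assumption [|f1 0| <= M] keeps it inside the period. *)
pose h := - (f1 0 / (2 * M)).
have M20 : 0 < 2 * M by rewrite mulr_gt0.
have h1 : `|h| <= 1 by rewrite /h normrN normrM normfV [`|2 * M|]gtr0_norm// ler_pdivrMr//; lra.
have hI : h \in `]- pi, pi[.
  by rewrite in_itv/= -ltr_norml (le_lt_trans h1)// (lt_le_trans _ (pi_ge2 R))// ltr1n.
have := @taylor_origin R f f1 f2 pi M h D1 D2 fM hI; rewrite ler_norml => /andP[_ H].
have := f0 h.
have E1 : f1 0 * h = - (f1 0 ^+ 2 / (2 * M)) by rewrite /h; field; rewrite gt_eqF.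
have E2 : M * h ^+ 2 = f1 0 ^+ 2 / (2 * M) / 2 by rewrite /h; field; rewrite gt_eqF.
rewrite E1 E2 in H => fh.
have : f1 0 ^+ 2 / (2 * M) / 2 <= f 0 by lra.
by rewrite ler_pdivrMr// ler_pdivrMr//; lra.
Qed.

(** [W], [P], [Q], [V] stand for [w], [w_x ^ 2], [w_xx], [v_x ^ 2], and [X], [Y] for [w] to the
    powers [beta - 1] and [alpha - 1]. Every term carries a factor [W], the first one through the
    bound on [P]. *)
Lemma w_speed_growth (R : realType) (kappa beta W X P Q Y V A B M N : R) :
  0 < kappa -> 1 <= beta -> 0 <= W -> 0 <= M -> 0 <= X -> X <= A -> 0 <= P ->
  P <= 4 * M * W -> Q <= M -> 0 <= Y -> Y <= B -> 0 <= V -> V <= N ^+ 2 ->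
  kappa * (beta * X * P + W * X * Q) + W * Y * V <=
  (kappa * (beta * A * (4 * M) + A * M) + B * N ^+ 2) * W.
Proof.
move=> k0 b1 W0 M0 X0 XA P0 PW QM Y0 YB V0 VN.
have b0 : 0 <= beta by exact: le_trans b1.
rewrite [leRHS]mulrDl lerD//.
  rewrite -[leRHS]mulrA ler_pM2l// [leRHS]mulrDl lerD//.
    by rewrite -[leRHS]mulrA; apply: ler_pM => //; [exact: mulr_ge0|exact: ler_wpM2l].
  rewrite -mulrA [leRHS]mulrC ler_wpM2l//.
  by apply: (@le_trans _ _ (X * M)); [exact: ler_wpM2l|exact: ler_wpM2r].
by rewrite -mulrA [leRHS]mulrC ler_wpM2l// ler_pM.
Qed.

Lemma vanishing_persists (R : realType) (kappa alpha beta t0 : R)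
    (v v1 v2 w w1 w2 : R -> R -> R) : 0 < kappa -> 1 <= alpha -> 1 <= beta ->
  C2_path R t0 v v1 v2 -> C2_path R t0 w w1 w2 ->
  (forall t x, 0 <= t < t0 -> 0 <= w t x) -> w 0 0 = 0 ->
  (forall t x, 0 < t < t0 -> x \in `]- pi, pi[ -> is_derive t 1 (fun s => w s x)
     (w_speed kappa alpha beta (w t x) (w1 t x) (w2 t x) (v1 t x))) ->
  forall t, 0 <= t < t0 -> w t 0 = 0.
Proof.
move=> k0 a1 b1 Cv Cw wpos w00 eqw T /andP[T0 Tt0].
have [M M1 wM] := @C2_path_bounded R t0 T _ _ _ Cw Tt0.
have [N N1 vN] := @C2_path_bounded R t0 T _ _ _ Cv Tt0.
have I0 := zero_in_pi R.
have M0 : 0 < M by exact: lt_le_trans M1.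
pose A := powR M (beta - 1); pose B := powR M (alpha - 1).
have A0 : 0 <= A by exact: powR_ge0.
have B0 : 0 <= B by exact: powR_ge0.
pose L := kappa * (beta * A * (4 * M) + A * M) + B * N ^+ 2.
(* Nonnegativity is one half of the equality, so Gronwall is only asked for the upper bound. *)
apply/eqP; rewrite eq_le wpos ?T0// andbT.
have cw0 : {within `[0, T], continuous (fun s => w s 0)}.
  by have [] := @C2_path_continuous R t0 T 0 _ _ _ Cw Tt0 I0.
have Dw0 t : t \in `]0, T[ -> is_derive t 1 (fun s => w s 0)
    (w_speed kappa alpha beta (w t 0) (w1 t 0) (w2 t 0) (v1 t 0)).
  by rewrite in_itv/= => /andP[t1 t2]; apply: eqw => //; rewrite t1 (lt_trans t2).
suff est t : t \in `]0, T[ ->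
    w_speed kappa alpha beta (w t 0) (w1 t 0) (w2 t 0) (v1 t 0) <= L * w t 0.
  by have := @gronwall_le0 R _ _ L T T0 cw0 Dw0 est; rewrite w00; exact.
rewrite in_itv/= => /andP[t1 t2].
have tT : 0 <= t <= T by rewrite !ltW.
have tt0 : 0 <= t < t0 by rewrite ltW//= (lt_trans t2).
have [W0 W1 W2] := wM t 0 tT I0; have [V0 V1 V2] := vN t 0 tT I0.
have w0 := wpos t 0 tt0.
have sq : w1 t 0 ^+ 2 <= 4 * M * w t 0.
  have [D _] := Cw t tt0.
  have D1 y : y \in `]- pi, pi[ -> is_derive y 1 (w t) (w1 t y) by move=> /D[].
  have D2 y : y \in `]- pi, pi[ -> is_derive y 1 (w1 t) (w2 t y) by move=> /D[].
  have D3 y : y \in `]- pi, pi[ -> `|w2 t y| <= M by move=> yI; have [] := wM t y tT yI.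
  exact: (@nonneg_derivative_sqr_le R _ _ _ M M0 D1 D2 D3 W1 (fun y => wpos t y tt0)).
have wle : w t 0 <= M by exact: le_trans (ler_norm _) W0.
have wA : powR (w t 0) (beta - 1) <= A.
  by apply: ge0_ler_powR; rewrite ?subr_ge0 ?nnegrE ?(ltW M0).
have wB : powR (w t 0) (alpha - 1) <= B.
  by apply: ge0_ler_powR; rewrite ?subr_ge0 ?nnegrE ?(ltW M0).
have Q : w2 t 0 <= M by exact: le_trans (ler_norm _) W2.
have V1s : v1 t 0 ^+ 2 <= N ^+ 2.
  rewrite -[v1 t 0 ^+ 2]real_normK ?num_real// lerXn2r ?nnegrE//.
  exact: le_trans (normr_ge0 _) V1.
rewrite /w_speed -(@mulr_powRB1 _ (w t 0) beta)// ?(lt_le_trans ltr01)//.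
rewrite -(@mulr_powRB1 _ (w t 0) alpha)// ?(lt_le_trans ltr01)//.
apply: w_speed_growth => //; rewrite ?powR_ge0 ?sqr_ge0//; exact: ltW.
Qed.

(** * Evolution of the Taylor coefficients at the origin *)

Lemma is_derive_dist (R : realType) (f : R -> R) (t df : R) :
  (forall e : R, 0 < e -> exists2 d : R, 0 < d & forall s, `|s - t| < d ->
    `|f s - f t - df * (s - t)| <= e * `|s - t|) ->
  is_derive t 1 f df.
Proof.
move=> H; apply/is_derive1_caratheodory.
exists (fun s => if s == t then df else (f s - f t) / (s - t)); split.
- by move=> s; case: eqP => [->|/eqP st]; rewrite ?subrr ?mulr0// divfK// subr_eq0.
- apply/cvgrPdist_le => e e0; have [d d0 Hd] := H e e0.
  apply/nbhs_ballP; exists d => //= s; rewrite /ball/= distrC eqxx => sd.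
  case: eqP => [_|/eqP st]; first by rewrite subrr normr0 ltW.
  have st0 : s - t != 0 by rewrite subr_eq0.
  rewrite distrC -(ler_pM2r (_ : 0 < `|s - t|)) ?normr_gt0// -normrM mulrBl divfK//.
  exact: Hd.
- by rewrite eqxx.
Qed.

(** Interchange of the time derivative with the limit in [x]. At fixed [x], the increment of
    [u / x ^ m] between [t] and [s] is [F c x / x ^ m * (s - t)] with [c] between them; [c] depends
    on [x], which is why the limit of [F / x ^ m] is required jointly. *)
Lemma is_derive_coefficient (R : realType) (u F : R -> R -> R) (A : R -> R) (m : nat) (t f r : R) :
  0 < r ->
  (forall s, `|s - t| < r -> u s x / x ^+ m @[x --> 0^'] --> A s) ->
  (forall s x, `|s - t| < r -> `|x| < r -> is_derive s 1 (fun z => u z x) (F s x)) ->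
  (fun p : R * R => F p.1 p.2 / p.2 ^+ m) @ filter_prod (nbhs t) (0 : R)^' --> f ->
  is_derive t 1 A f.
Proof.
move=> r0 uA uF Ff; apply: is_derive_dist => e e0.
have /cvgrPdist_le/(_ e e0)[[P Q] /= [/nbhs_ballP[d /= d0 tP] Q0] PQ] := Ff.
exists (Num.min r d); first by rewrite lt_min r0.
move=> s; rewrite lt_min => /andP[sr sd].
have tr : `|t - t| < r by rewrite subrr normr0.
pose g x := `|u s x / x ^+ m - u t x / x ^+ m - f * (s - t)|.
have gc : g x @[x --> 0^'] --> `|A s - A t - f * (s - t)|.
  apply: cvg_norm; apply: cvgB; last exact: cvg_cst.
  by apply: cvgB; exact: uA.
apply: (ler_cvg_to gc (cvg_cst (e * `|s - t|))).
near=> x.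
have x0 : x != 0 by near: x; exact: nbhs_dnbhs_neq.
have xr : `|x| < r.
  by near: x; apply: dnbhs0_lt.
have Qx : Q x by near: x.
have [c cs E] := @MVT_ball R (fun z => u z x) (fun z => F z x) t r s (fun y yr => uF y x yr xr) sr.
have := PQ (c, x); rewrite /g -mulrBl E => H.
have -> : F c x * (s - t) / x ^+ m - f * (s - t) = (F c x / x ^+ m - f) * (s - t) by ring.
rewrite normrM ler_wpM2r// distrC; apply: H; split => //=.
by apply: tP; rewrite /ball/= distrC (le_lt_trans cs).
Unshelve. all: by end_near. Qed.

(** Joint continuity at [(t, 0)], through the intermediate value at [(t, x)]: half of [e] goes to
    time, uniformly in [x], and half to space at the fixed time [t]. *)
Lemma C2_path_near (R : realType) (t0 t : R) (u u1 u2 : R -> R -> R) :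
  C2_path R t0 u u1 u2 -> 0 < t < t0 -> forall e : R, 0 < e ->
  exists2 d : R, 0 < d & forall s x, `|s - t| < d -> `|x| < d ->
  [/\ 0 < s < t0, x \in `]- pi, pi[, `|u1 s x - u1 t 0| <= e & `|u2 s x - u2 t 0| <= e].
Proof.
move=> Cu /andP[tp tt0] e e0; have e20 : 0 < e / 2 by rewrite divr_gt0.
have tI : 0 <= t < t0 by rewrite ltW.
have [D [_ /(_ _ e20)[d d0 Hd]]] := Cu t tI.
have [_ Dx c2] := D 0 (zero_in_pi R).
have c1 := @is_derive_continuous R _ _ _ Dx.
have /cvgrPdist_le/(_ _ e20)/nbhs_ballP[r1 /= r10 H1] := c1.
have /cvgrPdist_le/(_ _ e20)/nbhs_ballP[r2 /= r20 H2] := c2.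
pose m := Num.min d (Num.min (Num.min r1 r2) (Num.min pi (Num.min t (t0 - t)))).
exists m; first by rewrite !lt_min d0 r10 r20 pi_gt0 tp subr_gt0 tt0.
move=> s x; rewrite !lt_min => /andP[sd /andP[_ /and3P[_ st st0]]].
move=> /andP[xd /andP[/andP[xr1 xr2] /andP[xpi _]]].
have sI : 0 < s < t0.
  by move: st st0; rewrite !ltr_norml => /andP[? ?] /andP[? ?]; apply/andP; split; lra.
have xI : x \in `]- pi, pi[ by rewrite in_itv/= -ltr_norml.
have sI' : 0 <= s < t0 by case/andP: sI => /ltW -> ->.
have [_ A1 A2] := Hd s sI' sd x xI.
have b1 : `|u1 t x - u1 t 0| <= e / 2 by rewrite distrC; apply: H1; rewrite /ball/= sub0r normrN.
have b2 : `|u2 t x - u2 t 0| <= e / 2 by rewrite distrC; apply: H2; rewrite /ball/= sub0r normrN.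
split => //.
- by rewrite -[u1 s x](subrK (u1 t x)) -addrA [leRHS]splitr (le_trans (ler_normD _ _))// lerD.
- by rewrite -[u2 s x](subrK (u2 t x)) -addrA [leRHS]splitr (le_trans (ler_normD _ _))// lerD.
Qed.

Lemma near_time_space (R : realType) (t d : R) (P : R -> R -> Prop) : 0 < d ->
  (forall s x, `|s - t| < d -> `|x| < d -> x != 0 -> P s x) ->
  \forall p \near filter_prod (nbhs t) (0 : R)^', P p.1 p.2.
Proof.
move=> d0 H; exists (ball t d, [set x | `|x| < d /\ x != 0]) => /=.
  split; first exact: nbhsx_ballx.
  near=> x; split; first by near: x; exact: dnbhs0_lt.
  by near: x; exact: nbhs_dnbhs_neq.
by move=> [s x] /= [sd [xd x0]]; apply: H => //; rewrite distrC.
Unshelve. all: by end_near. Qed.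

Lemma cvg_time_space (R : realType) (t l : R) (g : R -> R -> R) :
  (forall e : R, 0 < e -> exists2 d : R, 0 < d & forall s x, `|s - t| < d -> `|x| < d ->
    x != 0 -> `|g s x - l| <= e) ->
  (fun p : R * R => g p.1 p.2) @ filter_prod (nbhs t) (0 : R)^' --> l.
Proof.
move=> H; apply/cvgrPdist_le => e e0; have [d d0 Hd] := H e e0.
apply: (@near_time_space R t d (fun s x => `|l - g s x| <= e)) => // s x sd xd x0.
by rewrite distrC; exact: Hd.
Qed.

Lemma cvg_space_slice (R : realType) (t l : R) (g : R -> R -> R) :
  (fun p : R * R => g p.1 p.2) @ filter_prod (nbhs t) (0 : R)^' --> l ->
  g t x @[x --> 0^'] --> l.
Proof.
move=> H; apply/cvgrPdist_le => e e0.
have /cvgrPdist_le/(_ e e0)[[A B] /= [At B0] AB] := H.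
by apply: filterS B0 => x Bx; apply: (AB (t, x)); split => //; exact: nbhs_singleton.
Qed.

Lemma C2_path_cvg (R : realType) (t0 t : R) (u u1 u2 : R -> R -> R) :
  C2_path R t0 u u1 u2 -> 0 < t < t0 ->
  (fun p : R * R => u1 p.1 p.2) @ filter_prod (nbhs t) (0 : R)^' --> u1 t 0 /\
  (fun p : R * R => u2 p.1 p.2) @ filter_prod (nbhs t) (0 : R)^' --> u2 t 0.
Proof.
move=> Cu tI; have H := @C2_path_near R t0 t u u1 u2 Cu tI.
by split; apply: cvg_time_space => e /H[d d0 Hd]; exists d => // s x sd xd _;
  have [] := Hd s x sd xd.
Qed.

Lemma C2_path_quotients (R : realType) (t0 t : R) (u u1 u2 : R -> R -> R) :
  C2_path R t0 u u1 u2 -> 0 < t < t0 ->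
  (fun p : R * R => (u p.1 p.2 - u p.1 0) / p.2) @ filter_prod (nbhs t) (0 : R)^' --> u1 t 0 /\
  (fun p : R * R => (u1 p.1 p.2 - u1 p.1 0) / p.2) @ filter_prod (nbhs t) (0 : R)^' --> u2 t 0.
Proof.
move=> Cu tI; have H := @C2_path_near R t0 t u u1 u2 Cu tI.
have D s x : 0 < s < t0 -> x \in `]- pi, pi[ ->
    is_derive x 1 (u s) (u1 s x) /\ is_derive x 1 (u1 s) (u2 s x).
  move=> /andP[/ltW s0 st0] xI; have sI : 0 <= s < t0 by rewrite s0.
  by have [/(_ x xI)[]] := Cu s sI.
split.
- apply: (@cvg_time_space R t _ (fun s x => (u s x - u s 0) / x)) => e /H[d d0 Hd].
  exists d => // s x sd xd x0; have [sI xI _ _] := Hd s x sd xd.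
  have [c cx ->] := @MVT_origin R (u s) (u1 s) pi x (fun y yI => (D s y sI yI).1) xI.
  by rewrite mulfK//; have [] := Hd s c sd (le_lt_trans cx xd).
- apply: (@cvg_time_space R t _ (fun s x => (u1 s x - u1 s 0) / x)) => e /H[d d0 Hd].
  exists d => // s x sd xd x0; have [sI xI _ _] := Hd s x sd xd.
  have [c cx ->] := @MVT_origin R (u1 s) (u2 s) pi x (fun y yI => (D s y sI yI).2) xI.
  by rewrite mulfK//; have [] := Hd s c sd (le_lt_trans cx xd).
Qed.

(** The parabola [a / 2 * y ^ 2] is subtracted with [a] frozen at [(t, 0)] while [s] varies. Two
    mean value steps leave [(w2 s b - a) * (c / x)] with [|c| <= |x|], small uniformly near
    [(t, 0)]. *)
Lemma C2_path_sqr_quotient (R : realType) (t0 t : R) (w w1 w2 : R -> R -> R) :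
  C2_path R t0 w w1 w2 -> 0 < t < t0 ->
  (forall s, 0 < s < t0 -> w s 0 = 0) -> (forall s, 0 < s < t0 -> w1 s 0 = 0) ->
  (fun p : R * R => w p.1 p.2 / p.2 ^+ 2) @ filter_prod (nbhs t) (0 : R)^' --> w2 t 0 / 2.
Proof.
move=> Cw tI w0 w10; have H := @C2_path_near R t0 t w w1 w2 Cw tI.
have D s x : 0 < s < t0 -> x \in `]- pi, pi[ ->
    is_derive x 1 (w s) (w1 s x) /\ is_derive x 1 (w1 s) (w2 s x).
  move=> /andP[/ltW s0 st0] xI; have sI : 0 <= s < t0 by rewrite s0.
  by have [/(_ x xI)[]] := Cw s sI.
apply: (@cvg_time_space R t _ (fun s x => w s x / x ^+ 2)) => e /H[d d0 Hd].
exists d => // s x sd xd x0; have [sI xI _ _] := Hd s x sd xd.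
pose a := w2 t 0; pose g y := w s y - a / 2 * y ^+ 2.
have Dg y : y \in `]- pi, pi[ -> is_derive y 1 g (w1 s y - a * y).
  move=> yI; have [Dw _] := D s y sI yI.
  have Dq : is_derive y 1 (fun y : R => a / 2 * y ^+ 2) (a * y).
    by apply: is_derive_eq; rewrite /GRing.scale/= ?expr1; field.
  exact: (is_deriveB Dw Dq).
have [c cx] := @MVT_origin R g _ pi x Dg xI.
rewrite /g w0// expr0n/= mulr0 subr0 subr0 => E.
have cd : `|c| < d by exact: le_lt_trans cx xd.
have cI : c \in `]- pi, pi[ by have [] := Hd s c sd cd.
have [b bc] := @MVT_origin R (w1 s) (w2 s) pi c (fun y yI => (D s y sI yI).2) cI.
rewrite w10// subr0 => E'.
have bE : `|w2 s b - a| <= e by have [] := Hd s b sd (le_lt_trans bc cd).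
have -> : w s x / x ^+ 2 - a / 2 = (w s x - a / 2 * x ^+ 2) / x ^+ 2.
  by field.
rewrite E E' -mulrBl.
have -> : (w2 s b - a) * c * x / x ^+ 2 = (w2 s b - a) * (c / x) by field.
rewrite normrM -[leRHS]mulr1 ler_pM// normrM normfV ler_pdivrMr ?mul1r//.
by rewrite normr_gt0.
Qed.

(** Source of the indicators in the coefficient equations. For [r = 1] the power is identically 1,
    also where [f] vanishes; for [r >= 2] the exponent [r - 1] is at least 1, so the power is
    squeezed between 0 and [f]. *)
Lemma powR_pred_cvg (R : realType) (T : Type) (F : set_system T) {FF : ProperFilter F}
    (f : T -> R) (r : R) : r = 1 \/ 2 <= r -> (\forall x \near F, 0 <= f x) ->
  f x @[x --> F] --> 0 -> powR (f x) (r - 1) @[x --> F] --> ((r == 1)%:R : R).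
Proof.
move=> [->|r2] f0 fcvg.
  rewrite eqxx subrr; under eq_fun do rewrite powRr0.
  exact: cvg_cst.
rewrite gt_eqF ?(lt_le_trans _ r2)// ?ltr1n//.
by apply: powR_cvg_0 => //; lra.
Qed.

Lemma w_coefficient_ode (R : realType) (kappa alpha beta t0 t : R)
    (v v1 v2 w w1 w2 : R -> R -> R) :
  alpha = 1 \/ 2 <= alpha -> beta = 1 \/ 2 <= beta ->
  C2_path R t0 v v1 v2 -> C2_path R t0 w w1 w2 ->
  (forall s x, 0 <= s < t0 -> 0 <= w s x) ->
  (forall s, 0 < s < t0 -> w s 0 = 0) -> (forall s, 0 < s < t0 -> w1 s 0 = 0) ->
  (forall s x, 0 < s < t0 -> x \in `]- pi, pi[ -> is_derive s 1 (fun z => w z x)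
     (w_speed kappa alpha beta (w s x) (w1 s x) (w2 s x) (v1 s x))) ->
  0 < t < t0 ->
  is_derive t 1 (fun s => w2 s 0)
    ((beta == 1)%:R * (3 * kappa) * w2 t 0 ^+ 2 + (alpha == 1)%:R * (w2 t 0 * v1 t 0 ^+ 2)).
Proof.
move=> aE bE Cv Cw wpos w0 w10 eqw tI.
have a0 : 0 < alpha by case: aE => [->//|]; lra.
have b0 : 0 < beta by case: bE => [->//|]; lra.
pose F : set_system (R * R) := filter_prod (nbhs t) (0 : R)^'.
have [d d0 Hd] := @C2_path_near R t0 t w w1 w2 Cw tI 1 ltr01.
have W0 := @C2_path_sqr_quotient R t0 t w w1 w2 Cw tI w0 w10.
have [_ W2] := @C2_path_cvg R t0 t w w1 w2 Cw tI.
have [V1 _] := @C2_path_cvg R t0 t v v1 v2 Cv tI.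
have [_ W1'] := @C2_path_quotients R t0 t w w1 w2 Cw tI.
have W1 : (fun p : R * R => w1 p.1 p.2 / p.2) @ F --> w2 t 0.
  apply: cvg_trans W1'; apply: near_eq_cvg.
  apply: (@near_time_space R t d (fun s x => (w1 s x - w1 s 0) / x = w1 s x / x)) => // s x sd xd _.
  by have [sI _ _ _] := Hd s x sd xd; rewrite w10// subr0.
have X : (fun p : R * R => p.2) @ F --> 0.
  by apply: (@cvg_time_space R t 0 (fun s x => x)) => e e0; exists e => // s x _ xe _; rewrite subr0 ltW.
have W : (fun p : R * R => w p.1 p.2) @ F --> 0.
  have W' : (fun p : R * R => w p.1 p.2 / p.2 ^+ 2 * (p.2 * p.2)) @ F --> w2 t 0 / 2 * (0 * 0).
    exact: (cvgM W0 (cvgM X X)).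
  rewrite !mulr0 in W'; apply: cvg_trans W'; apply: near_eq_cvg.
  apply: (@near_time_space R t d (fun s x => w s x / x ^+ 2 * (x * x) = w s x)) => // s x _ _ x0.
  by field.
have Wpos : \forall p \near F, 0 <= w p.1 p.2.
  apply: (@near_time_space R t d (fun s x => 0 <= w s x)) => // s x sd xd _.
  by have [/andP[/ltW s0 st] _ _ _] := Hd s x sd xd; apply: wpos; rewrite s0.
have PB : (fun p : R * R => powR (w p.1 p.2) (beta - 1)) @ F --> ((beta == 1)%:R : R) :=
  powR_pred_cvg R _ F (fun p => w p.1 p.2) beta bE Wpos W.
have PA : (fun p : R * R => powR (w p.1 p.2) (alpha - 1)) @ F --> ((alpha == 1)%:R : R) :=
  powR_pred_cvg R _ F (fun p => w p.1 p.2) alpha aE Wpos W.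
have lim : (fun p : R * R => w_speed kappa alpha beta (w p.1 p.2) (w1 p.1 p.2)
      (w2 p.1 p.2) (v1 p.1 p.2) / p.2 ^+ 2) @ F -->
    kappa * (beta * (beta == 1)%:R * (w2 t 0 * w2 t 0) +
      w2 t 0 / 2 * (beta == 1)%:R * w2 t 0) +
    w2 t 0 / 2 * (alpha == 1)%:R * (v1 t 0 * v1 t 0).
  (* The division by [x ^ 2] is distributed so that every factor converges: one [x] under each [w1],
     or [x ^ 2] under the factor [w] split off from the power. *)
  have G : (fun p : R * R => kappa * (beta * powR (w p.1 p.2) (beta - 1) *
      ((w1 p.1 p.2 / p.2) * (w1 p.1 p.2 / p.2)) +
      w p.1 p.2 / p.2 ^+ 2 * powR (w p.1 p.2) (beta - 1) * w2 p.1 p.2) +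
      w p.1 p.2 / p.2 ^+ 2 * powR (w p.1 p.2) (alpha - 1) * (v1 p.1 p.2 * v1 p.1 p.2)) @ F -->
    kappa * (beta * (beta == 1)%:R * (w2 t 0 * w2 t 0) +
      w2 t 0 / 2 * (beta == 1)%:R * w2 t 0) +
    w2 t 0 / 2 * (alpha == 1)%:R * (v1 t 0 * v1 t 0).
    have T1 : (fun p : R * R => w p.1 p.2 / p.2 ^+ 2 * powR (w p.1 p.2) (alpha - 1)) @ F -->
        w2 t 0 / 2 * (alpha == 1)%:R by apply: cvgM; [exact: W0|exact: PA].
    have T2 : (fun p : R * R => w p.1 p.2 / p.2 ^+ 2 * powR (w p.1 p.2) (beta - 1)) @ F -->
        w2 t 0 / 2 * (beta == 1)%:R by apply: cvgM; [exact: W0|exact: PB].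
    apply: cvgD; last by apply: cvgM; [exact: T1|apply: cvgM; exact: V1].
    apply: cvgM; first exact: cvg_cst.
    apply: cvgD; last by apply: cvgM; [exact: T2|exact: W2].
    apply: cvgM; last by apply: cvgM; exact: W1.
    by apply: cvgM; [exact: cvg_cst|exact: PB].
  apply: cvg_trans G; apply: near_eq_cvg.
  apply: (@near_time_space R t d (fun s x =>
      kappa * (beta * powR (w s x) (beta - 1) * ((w1 s x / x) * (w1 s x / x)) +
      w s x / x ^+ 2 * powR (w s x) (beta - 1) * w2 s x) +
      w s x / x ^+ 2 * powR (w s x) (alpha - 1) * (v1 s x * v1 s x) =
      w_speed kappa alpha beta (w s x) (w1 s x) (w2 s x) (v1 s x) / x ^+ 2)) => // s x sd xd x0.
  have [/andP[/ltW s0 st] _ _ _] := Hd s x sd xd.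
  have wsx : 0 <= w s x by apply: wpos; rewrite s0.
  rewrite /w_speed -(@mulr_powRB1 _ (w s x) beta)// -(@mulr_powRB1 _ (w s x) alpha)//.
  by field.
(* The Taylor coefficient is [w2 / 2]; the factor 2 is restored afterwards. *)
have D : is_derive t 1 (fun s => w2 s 0 / 2) (kappa * (beta * (beta == 1)%:R * (w2 t 0 * w2 t 0) +
      w2 t 0 / 2 * (beta == 1)%:R * w2 t 0) +
    w2 t 0 / 2 * (alpha == 1)%:R * (v1 t 0 * v1 t 0)).
  apply: (@is_derive_coefficient R w _ _ 2 t _ d d0 _ _ lim).
  - move=> s sd; have sI : 0 < s < t0 by have [] := Hd s 0 sd; rewrite ?normr0.
    exact: (@cvg_space_slice R s _ (fun s x => w s x / x ^+ 2) (@C2_path_sqr_quotient R t0 s w w1 w2 Cw sI w0 w10)).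
  - by move=> s x sd xd; have [sI xI _ _] := Hd s x sd xd; exact: eqw.
have D2 := is_deriveZ 2 D.
rewrite (_ : (fun s => w2 s 0) = 2 \*: (fun s => w2 s 0 / 2)); last first.
  by apply/funext => s; rewrite -[RHS]/(2 * (w2 s 0 / 2)); field.
apply: is_derive_eq D2 _; rewrite -[LHS]/(2 * _).
by case: (eqVneq beta 1) => [->|_]; case: (alpha == 1); rewrite /=; field.
Qed.

(** The coefficient is taken of [v - v 0]; the value at the origin is stationary because [w] and
    [w1] vanish there. In the right-hand side divided by [x], [w1 / x] tends to [w2 t 0], while
    [w / x] tends to 0. *)
Lemma v_coefficient_ode (R : realType) (t0 t : R) (v v1 v2 w w1 w2 : R -> R -> R) :
  C2_path R t0 v v1 v2 -> C2_path R t0 w w1 w2 ->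
  (forall s, 0 < s < t0 -> w s 0 = 0) -> (forall s, 0 < s < t0 -> w1 s 0 = 0) ->
  (forall s x, 0 < s < t0 -> x \in `]- pi, pi[ ->
    is_derive s 1 (fun z => v z x) (w1 s x * v1 s x + w s x * v2 s x)) ->
  0 < t < t0 -> is_derive t 1 (fun s => v1 s 0) (w2 t 0 * v1 t 0).
Proof.
move=> Cv Cw w0 w10 eqv tI.
pose F : set_system (R * R) := filter_prod (nbhs t) (0 : R)^'.
have [d d0 Hd] := @C2_path_near R t0 t w w1 w2 Cw tI 1 ltr01.
have W0 := @C2_path_sqr_quotient R t0 t w w1 w2 Cw tI w0 w10.
have [V1 V2] := @C2_path_cvg R t0 t v v1 v2 Cv tI.
have [_ W1] := @C2_path_quotients R t0 t w w1 w2 Cw tI.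
have X : (fun p : R * R => p.2) @ F --> 0.
  by apply: (@cvg_time_space R t 0 (fun s x => x)) => e e0; exists e => // s x _ xe _; rewrite subr0 ltW.
have lim : (fun p : R * R => (w1 p.1 p.2 * v1 p.1 p.2 + w p.1 p.2 * v2 p.1 p.2) / p.2 ^+ 1) @ F -->
    w2 t 0 * v1 t 0.
  have G : (fun p : R * R => (w1 p.1 p.2 - w1 p.1 0) / p.2 * v1 p.1 p.2 +
      w p.1 p.2 / p.2 ^+ 2 * p.2 * v2 p.1 p.2) @ F --> w2 t 0 * v1 t 0 + w2 t 0 / 2 * 0 * v2 t 0.
    exact: (cvgD (cvgM W1 V1) (cvgM (cvgM W0 X) V2)).
  rewrite mulr0 mul0r addr0 in G; apply: cvg_trans G; apply: near_eq_cvg.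
  apply: (@near_time_space R t d (fun s x => (w1 s x - w1 s 0) / x * v1 s x +
      w s x / x ^+ 2 * x * v2 s x = (w1 s x * v1 s x + w s x * v2 s x) / x ^+ 1)) => // s x sd xd x0.
  by have [sI _ _ _] := Hd s x sd xd; rewrite w10// expr1; field.
apply: (@is_derive_coefficient R (fun s x => v s x - v s 0)
  (fun s x => w1 s x * v1 s x + w s x * v2 s x) _ 1 t _ d d0 _ _ lim).
- move=> s sd; have sI : 0 < s < t0 by have [] := Hd s 0 sd; rewrite ?normr0.
  have [H _] := @C2_path_quotients R t0 s v v1 v2 Cv sI.
  have := @cvg_space_slice R s _ (fun s x => (v s x - v s 0) / x) H.
  by under eq_fun do rewrite -[X in _ / X]expr1.
- move=> s x sd xd; have [sI xI _ _] := Hd s x sd xd.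
  have D0 := eqv s 0 sI (zero_in_pi R); rewrite w0// w10// !mul0r addr0 in D0.
  by have DB := is_deriveB (eqv s x sI xI) D0; rewrite subr0 in DB; exact: DB.
Qed.

(** * Blow-up *)

(** [1 / a + K s] is nonincreasing because [(1 / a)' = - a' / a ^ 2 <= - K], and its value at 0 is
    exactly [K * t0]. Monotonicity of [a] comes first, to keep [a] positive and the inverse
    meaningful. *)
Lemma riccati_blowup (R : realType) (a da : R -> R) (K t0 : R) :
  0 < K -> 0 < a 0 -> t0 = (K * a 0)^-1 ->
  (forall T, 0 <= T < t0 -> {within `[0, T], continuous a}) ->
  (forall t : R, 0 < t < t0 -> is_derive t 1 a (da t)) ->
  (forall t, 0 < t < t0 -> K * a t ^+ 2 <= da t) ->
  a t @[t --> t0^'-] --> +oo.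
Proof.
move=> K0 a00 t0E ca Da da_ge.
have sub T t : 0 <= T < t0 -> t \in `]0, T[ -> 0 < t < t0.
  by rewrite in_itv/= => /andP[_ Tt0] /andP[-> tT]; rewrite (lt_trans tT).
have a0_le t : 0 <= t < t0 -> a 0 <= a t.
  move=> tI; have [t_ge _] := andP tI.
  have H1 s : s \in `]0, t[ -> derivable a s 1 by move=> /(sub t s tI)/Da[].
  have H2 s : s \in `]0, t[ -> 0 <= derive1 a s.
    move=> /(sub t s tI) sI; rewrite derive1E (@derive_val _ _ _ _ _ _ _ (Da s sI)).
    by apply: le_trans (da_ge s sI); rewrite mulr_ge0 ?sqr_ge0// ltW.
  have I0 : 0 \in `[0, t] by rewrite in_itv/= lexx.
  have It : t \in `[0, t] by rewrite in_itv/= lexx andbT.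
  exact: (ger0_derive1_le_cc H1 H2 (ca t tI) I0 It t_ge).
have a_pos t : 0 <= t < t0 -> 0 < a t by move=> /a0_le; exact: lt_le_trans.
have inv_le t : 0 <= t < t0 -> (a t)^-1 <= K * (t0 - t).
  move=> tI; have [t_ge _] := andP tI.
  pose g s := (a s)^-1 + K * s.
  have Dg s : s \in `]0, t[ -> is_derive s 1 g (- da s / a s ^+ 2 + K).
    move=> /(sub t s tI) sI; have as0 : a s != 0.
      by rewrite gt_eqF// a_pos//; case/andP : sI => /ltW -> ->.
    have DV := @is_deriveV _ _ _ _ _ as0 (Da s sI).
    have DK : is_derive s 1 (fun s : R => K * s) K by apply: is_derive_eq; exact: mulr1.
    have DD := is_deriveD DV DK; apply: is_derive_eq DD _; congr (_ + _).
    by rewrite -[LHS]/(- _ * da s); field.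
  have H1 s : s \in `]0, t[ -> derivable g s 1 by move=> /Dg[].
  have H2 s : s \in `]0, t[ -> derive1 g s <= 0.
    move=> sI'; have sI := sub t s tI sI'.
    rewrite derive1E (@derive_val _ _ _ _ _ _ _ (Dg s sI')) mulNr addrC subr_le0.
    rewrite ler_pdivlMr ?da_ge// exprn_gt0// a_pos//.
    by case/andP : sI => /ltW -> ->.
  have H3 : {within `[0, t], continuous g}.
    apply/subspace_continuousP => s sI; apply: cvgD.
      apply: cvgV; last by move/subspace_continuousP : (ca t tI); exact.
      rewrite gt_eqF// a_pos//; move: sI; rewrite /= in_itv/= => /andP[-> st] /=.
      by case/andP : tI => _; exact: le_lt_trans.
    by apply: cvgM; [exact: cvg_cst|apply: cvg_within_filter; exact: cvg_id].
  have I0 : 0 \in `[0, t] by rewrite in_itv/= lexx.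
  have It : t \in `[0, t] by rewrite in_itv/= lexx andbT.
  have : g t <= g 0 := ler0_derive1_le_cc H1 H2 H3 It I0 t_ge.
  rewrite /g mulr0 addr0 mulrBr t0E invfM mulrA mulfV ?gt_eqF// mul1r.
  by rewrite lerBrDr.
apply/cvgryPge => A; pose B := `|A| + 1.
have B0 : 0 < B by rewrite ltr_wpDl.
have t0_gt0 : 0 < t0 by rewrite t0E invr_gt0 mulr_gt0.
have KB : 0 < (K * B)^-1 by rewrite invr_gt0 mulr_gt0.
near=> t.
have tt0 : t < t0 by near: t; exact: nbhs_left_lt.
have t_gt0 : 0 < t by near: t; exact: nbhs_left_gt.
(* From this time on, [K * (t0 - t) <= 1 / B], so [a t >= B]. *)
have tB : t0 - (K * B)^-1 < t by near: t; apply: nbhs_left_gt; rewrite ltrBlDr ltrDl.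
have tI : 0 <= t < t0 by rewrite ltW.
have H : (a t)^-1 <= B^-1.
  apply: (le_trans (inv_le t tI)); rewrite -ler_pdivlMl// -invfM.
  by rewrite lerBlDl -lerBlDr ltW.
have AB : A <= B by rewrite (le_trans (ler_norm _))// lerDl.
by apply: (le_trans AB); rewrite -lef_pV2// posrE a_pos.
Unshelve. all: by end_near. Qed.

Lemma constant_of_zero_derive (R : realType) (c : R -> R) (T : R) : 0 <= T ->
  {within `[0, T], continuous c} ->
  (forall t : R, t \in `]0, T[ -> is_derive t 1 c 0) -> c T = c 0.
Proof.
move=> T0 cc Dc; have [z _] := MVT_segment T0 (df := fun=> 0) Dc cc.
by rewrite mul0r => /eqP; rewrite subr_eq0 => /eqP.
Qed.

Lemma C2_path_derive1 (R : realType) (t0 t : R) (u u1 u2 : R -> R -> R) :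
  C2_path R t0 u u1 u2 -> 0 <= t < t0 ->
  derive1 (u t) 0 = u1 t 0 /\ derive1n 2 (u t) 0 = u2 t 0.
Proof.
move=> Cu tI; have [D _] := Cu t tI.
have E1 y : y \in `]- pi, pi[ -> derive1 (u t) y = u1 t y.
  by move=> /D[Dy _ _]; rewrite derive1E; exact: (@derive_val _ _ _ _ _ _ _ Dy).
split; first exact: E1 (zero_in_pi R).
rewrite derive1nS derive1n1 derive1E; have [_ D2 _] := D 0 (zero_in_pi R).
apply: derive_val; apply: near_eq_is_derive D2.
by near=> y; apply/esym/E1; near: y; exact/in_oo_nbhs/zero_in_pi.
Unshelve. all: by end_near. Qed.

Theorem theorem3p1 (R : realType) (kappa0 alpha beta : R) (v0 w0 : R -> R) :
  0 < kappa0 -> 1 <= alpha -> 1 <= beta ->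
  ((beta = 1 /\ (alpha = 1 \/ 2 <= alpha)) \/
   ((beta = 2 \/ 3 <= beta) /\ alpha = 1)) ->
  H5 v0 -> H5 w0 -> (forall x, 0 <= w0 x) ->
  odd_fun v0 -> even_fun w0 ->
  w0 0 = 0 -> 0 < derive1n 2 w0 0 ->
  ((beta = 2 \/ 3 <= beta) /\ alpha = 1 ->
     Num.sqrt (2 * derive1n 2 w0 0) <= derive1 v0 0) ->
  exists2 t0 : R, 0 < t0 &
    forall v w : R -> R -> R,
      classical_solution kappa0 alpha beta v0 w0 t0 v w ->
      (fun t => derive1n 2 (w t) 0) @ at_left t0 --> +oo.
Proof.
move=> k0 a1 b1 cases _ _ _ _ _ w00 a0 sqrt_le.
have aE : alpha = 1 \/ 2 <= alpha by case: cases => -[_]; [|left].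
have bE : beta = 1 \/ 2 <= beta.
  by case: cases => [[-> _]|[[->|b3] _]]; [left|right|right; lra].
pose K : R := if beta == 1 then 3 * kappa0 else 2.
have K0 : 0 < K by rewrite /K; case: ifP => // _; rewrite mulr_gt0.
pose t0 := (K * derive1n 2 w0 0)^-1.
have t0_gt0 : 0 < t0 by rewrite invr_gt0 mulr_gt0.
exists t0 => // v w sol.
have [v1 [v2 [w1 [w2 [Cv Cw eqw eqv]]]]] :=
  @classical_solution_pointwise R kappa0 alpha beta t0 v0 w0 v w a1 b1 sol.
case: sol => _ [_ [v0E [w0E [wpos _]]]].
have I0 : (0 : R) <= 0 < t0 by rewrite lexx t0_gt0.
have tw t : 0 < t < t0 -> 0 <= t < t0 by move=> /andP[/ltW -> ->].
have wz : forall t, 0 <= t < t0 -> w t 0 = 0.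
  by apply: (@vanishing_persists R kappa0 alpha beta t0 v v1 v2 w w1 w2) => //; rewrite w0E.
have wz' t : 0 < t < t0 -> w t 0 = 0 by move=> /tw/wz.
have w1z t : 0 < t < t0 -> w1 t 0 = 0.
  move=> tI; have [D _] := Cw t (tw t tI).
  apply: (@nonneg_zero_derive R (w t) (w1 t) pi); [|exact: zero_in_pi| |exact: wz'].
  - by move=> y /D[].
  - by move=> y; exact/wpos/tw.
have aode t (tI : 0 < t < t0) := @w_coefficient_ode R kappa0 alpha beta t0 t
  v v1 v2 w w1 w2 aE bE Cv Cw wpos wz' w1z eqw tI.
(* Limit of the nonnegative quotients [w / x ^ 2]. The sign serves twice: it makes the term
   [a b ^ 2] nonnegative when [beta = 1], and it multiplies [b ^ 2 >= 2 a] in case (b). *)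
have a_ge0 t : 0 < t < t0 -> 0 <= w2 t 0.
  move=> tI; have H := @cvg_space_slice R t _ (fun s x => w s x / x ^+ 2)
    (@C2_path_sqr_quotient R t0 t w w1 w2 Cw tI wz' w1z).
  have : 0 <= w2 t 0 / 2; last by lra.
  apply: (cvgr_to_ge H); near=> x.
  by rewrite mulr_ge0// ?invr_ge0 ?sqr_ge0//; exact/wpos/tw.
have [_ aE0] := @C2_path_derive1 R t0 0 w w1 w2 Cw I0; rewrite w0E in aE0.
have [bE0 _] := @C2_path_derive1 R t0 0 v v1 v2 Cv I0; rewrite v0E in bE0.
have cont T : 0 <= T < t0 -> {within `[0, T], continuous (fun s => w2 s 0)}.
  by move=> /andP[_ TI]; have [] := @C2_path_continuous R t0 T 0 w w1 w2 Cw TI (zero_in_pi R).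
suff blow : w2 t 0 @[t --> t0^'-] --> +oo.
  apply: cvg_trans blow; apply: near_eq_cvg; near=> t.
  have tI : 0 <= t < t0.
    by apply/andP; split; near: t; [exact: nbhs_left_ge|exact: nbhs_left_lt].
  by have [_ ->] := @C2_path_derive1 R t0 t w w1 w2 Cw tI.
apply: (@riccati_blowup R (fun t => w2 t 0) _ K t0 K0 _ _ cont aode).
- by rewrite -aE0.
- by rewrite -aE0.
move=> t tI; rewrite /K; have [bet|bet] := eqVneq beta 1.
  rewrite mul1r lerDl mulr_ge0// mulr_ge0 ?sqr_ge0//; exact: a_ge0.
have al : alpha = 1 by case: cases => [[/eqP]|[]]; rewrite ?(negPf bet).
rewrite mul0r mul0r add0r al eqxx mul1r.
have bode s (sI : 0 < s < t0) :=
  @v_coefficient_ode R t0 s v v1 v2 w w1 w2 Cv Cw wz' w1z (eqv al) sI.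
(* Conservation is the cancellation [2 b (a b) - 2 (a b ^ 2) = 0], available because the [kappa0]
   term is absent for [beta] different from 1. Squaring the condition on the initial slope of [v]
   makes the conserved value nonnegative. *)
suff inv : v1 t 0 ^+ 2 - 2 * w2 t 0 = v1 0 0 ^+ 2 - 2 * w2 0 0.
  have : 0 <= v1 t 0 ^+ 2 - 2 * w2 t 0.
    have sq : Num.sqrt (2 * derive1n 2 w0 0) <= derive1 v0 0.
      by apply: sqrt_le; case: cases => [[/eqP]|//]; rewrite (negPf bet).
    have a20 : 0 <= 2 * derive1n 2 w0 0 by rewrite mulr_ge0// ltW.
    rewrite inv -aE0 -bE0 subr_ge0 -[leLHS]sqr_sqrtr//.
    by rewrite lerXn2r// nnegrE ?sqrtr_ge0// (le_trans _ sq)// sqrtr_ge0.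
  by have := a_ge0 t tI => *; rewrite expr2; nra.
have [t_gt0 tt0] := andP tI.
pose c s := v1 s 0 ^+ 2 - 2 * w2 s 0.
have cc : {within `[0, t], continuous c}.
  have [_ cv _] := @C2_path_continuous R t0 t 0 v v1 v2 Cv tt0 (zero_in_pi R).
  have cw := cont t (tw t tI).
  move=> s; apply: cvgB; first by apply: cvgM; exact: cv.
  by apply: cvgM; [exact: cvg_cst|exact: cw].
have Dc s : s \in `]0, t[ -> is_derive s 1 c 0.
  rewrite in_itv/= => /andP[s0 st].
  have sI : 0 < s < t0 by rewrite s0 (lt_trans st).
  have Db := bode s sI; have Da := aode s sI.
  have D1 := is_deriveM Db Db; have D2 := is_deriveZ 2 Da.
  have DD := is_deriveB D1 D2; apply: is_derive_eq DD _.
  by rewrite (negPf bet) al eqxx -[LHS]/(_ * _ + _ * _ - 2 * _) /=; ring.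
exact: (@constant_of_zero_derive R c t (ltW t_gt0) cc Dc).
Unshelve. all: by end_near. Qed.
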